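(* Every ergodic central measure on the path space of the one-dimensional Gelfand--Tsetlin graph (Cesàro graph) is an exponential random walk over the levels of the graph: there exists $\lambda>0$ such that under this measure the random variables $x_0,\ x_1-x_0,\ x_2-x_1,\dots$ are independent and identically distributed with the exponential distribution of mean $\lambda$ (density $\lambda^{-1}e^{-t/\lambda}$ on $(0,\infty)$). Thus any such measure is concentrated on the series $x_0+(x_1-x_0)+(x_2-x_1)+\dots$ whose sequence of terms has Cesàro limit $\lambda$, i.e. $x_n/n\to\lambda$.
   Context: The Cesàro graph (one-dimensional Gelfand--Tsetlin graph) has level-$n$ vertex set $\Gamma_n=[0,\infty)$ for every $n\geqslant 0$, and a vertex $x\in\Gamma_n$ is joined by an edge to $y\in\Gamma_{n+1}$ iff $x\leqslant y$. Its path space is the set of all sequences $0\leqslant x_0\leqslant x_1\leqslant x_2\leqslant\dots$, with the topology and Borel structure induced from $\mathbb R^{\{0,1,2,\dots\}}$. For $n\geqslant 1$ and an interior vertex $a\in\Gamma_n$ (that is, $a>0$), the set of paths from level $0$ to $a$ is identified with the simplex $\{0\leqslant x_0\leqslant\dots\leqslant x_{n-1}\leqslant a\}$, and $\mu_a$ denotes the normalized Lebesgue measure on it. A Borel probability measure on the path space is called central if for every $n\geqslant 1$ the conditional distribution of the initial segment $(x_0,\dots,x_{n-1})$ given the tail $(x_n,x_{n+1},\dots)$ is almost surely the measure $\mu_{x_n}$ (with $x_n$ regarded as a vertex of level $n$); since $\mu_a$ is defined for interior vertices, this includes that $x_n>0$ almost surely for $n\geqslant 1$. A central measure is ergodic (indecomposable)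 if it is not a nontrivial convex combination of two distinct central probability measures. *)

(* Defs.v *)
From HB Require Import structures.
From mathcomp Require Import all_boot all_order all_algebra finmap.
From mathcomp Require Import all_classical all_reals all_analysis.
From mathcomp Require Import measurable_realfun.

Set Implicit Arguments.
Unset Strict Implicit.
Unset Printing Implicit Defensive.

Import Order.TTheory GRing.Theory Num.Theory.
Import numFieldNormedType.Exports.

Local Open Scope classical_set_scope.
Local Open Scope ring_scope.

(** * Path space *)

(* A path visits the vertex x n of level n; the levels are all [0, +oo[ and
   x n is joined to x n.+1 iff x n <= x n.+1. *)
Definition path_set (R : realType) : set {ptws nat -> R} :=
  [set x | (forall n, 0 <= x n) /\ (forall n, x n <= x n.+1)].

Definition gt_path (R : realType) := set_type (@path_set R).

HB.instance Definition _ (R : realType) := Topological.on (gt_path R).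

Lemma path_set_cst0 (R : realType) : path_set (fun _ => 0 : R).
Proof. by split. Qed.

HB.instance Definition _ (R : realType) :=
  isPointed.Build (gt_path R) (SigSub (mem_set (@path_set_cst0 R))).

(* The measurable sets of path_space R are the Borel sets of the topology
   induced on gt_path R by the product topology. *)
Definition path_space (R : realType) :=
  g_sigma_algebraType (@open (gt_path R)).

HB.instance Definition _ (R : realType) := Measurable.on (path_space R).

Definition vertex (R : realType) (n : nat) (x : path_space R) : R :=
  (set_val (x : gt_path R) : nat -> R) n.

Definition initial_segment (R : realType) (n : nat) (x : path_space R) :
  n.-tuple R := [tuple vertex i x | i < n].

Lemma path_set_shift (R : realType) (n : nat) (x : gt_path R) :
  path_set (fun k => (set_val x : nat -> R) (n + k)%N).
Proof.
have [x0 xS] := set_valP x.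
by split=> k; [exact: x0|rewrite addnS; exact: xS].
Qed.

(* The sequence (x_n, x_{n+1}, ...) is again nondecreasing and nonnegative, so
   the tail takes its values in the path space. *)
Definition tail (R : realType) (n : nat) (x : path_space R) : path_space R :=
  SigSub (mem_set (path_set_shift n (x : gt_path R))).

(* The n-th term of the series x_0 + (x_1 - x_0) + (x_2 - x_1) + ... *)
Definition increment (R : realType) (n : nat) (x : path_space R) : R :=
  if n is m.+1 then vertex m.+1 x - vertex m x else vertex 0 x.

Lemma measurable_vertex (R : realType) (n : nat) :
  measurable_fun [set: path_space R] (@vertex R n).
Proof.
apply: (measurability _ (RGenOInfty.measurableE R)) => _ [_ [a ->] <-].
rewrite setTI; apply: sub_sigma_algebra.
pose f : {ptws nat -> R} -> R := @proj nat (fun=> R) n.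
exists (f @^-1` `]a, +oo[) => //.
have /(_ `]a, +oo[%classic) : forall A : set R, open A -> open (f @^-1` A).
  by apply/continuousP; exact: (@proj_continuous nat (fun=> R) n).
by apply; exact: (@interval_open R (BRight a) +oo%O).
Qed.

Lemma measurable_increment (R : realType) (n : nat) :
  measurable_fun [set: path_space R] (@increment R n).
Proof.
case: n => [|n]; first exact: measurable_vertex.
by apply: measurable_funB; exact: measurable_vertex.
Qed.

HB.instance Definition _ (R : realType) (n : nat) :=
  isMeasurableFun.Build _ _ _ _ (@increment R n) (@measurable_increment R n).

(** * Simplices and their normalized Lebesgue measure *)

(* Lebesgue measure on R^n: the n-fold product of Lebesgue measure on R
   (the unit mass at the empty tuple for n = 0). *)
Fixpoint lebesgue_tuple (R : realType) (n : nat) :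
    set (n.-tuple R) -> \bar R :=
  match n with
  | 0 => \d_([tuple] : 0.-tuple R)
  | m.+1 => pushforward (@lebesgue_measure R \x @lebesgue_tuple R m)%E
      (fun p : R * m.-tuple R => [tuple of p.1 :: p.2])
  end.

(* path <=%R 0 (rcons s a) reads 0 <= s_0 <= ... <= s_{n-1} <= a. *)
Definition simplex (R : realType) (n : nat) (a : R) : set (n.-tuple R) :=
  [set s | path <=%R 0 (rcons s a)].
Arguments simplex {R} n a.

(* The measure mu_a of the vertex a of level n, for n >= 1 and a > 0. *)
Definition simplex_unif (R : realType) (n : nat) (a : R)
    (A : set (n.-tuple R)) : \bar R :=
  (lebesgue_tuple (A `&` simplex n a) / lebesgue_tuple (simplex n a))%E.
Arguments simplex_unif {R} n a A.

(** * Central measures *)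

(* k is (a version of) the conditional distribution of X given Y. *)
Definition cond_distribution d d1 d2 (T : measurableType d)
    (T1 : measurableType d1) (T2 : measurableType d2) (R : realType)
    (P : probability T R) (X : T -> T1) (Y : T -> T2)
    (k : T2 -> set T1 -> \bar R) : Prop :=
  (forall A, measurable A -> measurable_fun [set: T2] (k ^~ A)) /\
  (forall A B, measurable A -> measurable B ->
     P (X @^-1` A `&` Y @^-1` B) = \int[P]_(w in Y @^-1` B) k (Y w) A)%E.

(* vertex 0 (tail n x) = x_n. The kernel is irrelevant where x_n = 0, since
   the first clause makes this event negligible. *)
Definition central (R : realType) (P : probability (path_space R) R) : Prop :=
  forall n, (1 <= n)%N ->
    {ae P, forall x, 0 < vertex n x} /\
    cond_distribution P (@initial_segment R n) (@tail R n)
      (fun y => simplex_unif n (vertex 0 y)).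

(* Values of a measure on nonmeasurable sets are meaningless, hence equality
   of measures is equality on measurable sets. *)
Definition eq_measure d (T : measurableType d) (R : realType)
    (m1 m2 : set T -> \bar R) : Prop :=
  forall A, measurable A -> m1 A = m2 A.

Definition ergodic (R : realType) (P : probability (path_space R) R) : Prop :=
  central P /\
  ~ exists (P1 P2 : probability (path_space R) R) (t : R),
      [/\ central P1, central P2, ~ eq_measure P1 P2, 0 < t < 1
        & eq_measure P (fun A => t%:E * P1 A + (1 - t)%:E * P2 A)%E].

(** * Exponential random walks *)

Definition independent_RVs d (T : measurableType d) (R : realType)
    (P : probability T R) (I : choiceType) (X : I -> {RV P >-> R}) : Prop :=
  forall (J : {fset I}) (A : I -> set R),
    (forall i, i \in J -> measurable (A i)) ->
    P (\bigcap_(i in [set` J]) (X i @^-1` A i)) =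
    (\prod_(i <- J) P (X i @^-1` A i))%E.

(* exponential_prob takes the rate, which is the inverse of the mean. *)
Definition exponential_walk (R : realType) (lambda : R)
    (P : probability (path_space R) R) : Prop :=
  independent_RVs (fun n : nat => @increment R n : {RV P >-> R}) /\
  forall n, eq_measure (distribution P (@increment R n : {RV P >-> R}))
              (exponential_prob lambda^-1).

(* Main.v *)
Require Import Defs.
From HB Require Import structures.
From mathcomp Require Import all_boot all_order all_algebra finmap.
From mathcomp Require Import all_classical all_reals all_analysis.
From mathcomp Require Import measurable_realfun.
From mathcomp Require Import ring lra.

Set Implicit Arguments.
Unset Strict Implicit.
Unset Printing Implicit Defensive.

Import Order.TTheory GRing.Theory Num.Theory.
Import numFieldNormedType.Exports.

Local Open Scope classical_set_scope.
Local Open Scope ring_scope.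

(** Write d_0 = x_0 and d_n = x_n - x_(n-1) for the increments of a path.
    Given x_n, a central measure makes (x_0, ..., x_(n-1)) uniform on the
    simplex of x_n, and the sub-simplex where d_i >= s_i for all i < n is a
    translate of the simplex of x_n - (s_0 + ... + s_(n-1)).  Lebesgue measure
    is translation invariant, so the probability of the orthant
    {d_i >= s_i for all i < n} depends on the sum of the s_i only
    ([central_orthant]); the volume of a simplex is never computed.

    Extremality enters through one decomposition.  Fix c >= 0.  The symmetry
    of the orthants shows that dropping the first increment preserves a central
    measure P ([central_drop_first]).  Splitting according to x_0 >= c or
    x_0 < c therefore writes P as a mixture of the laws of (d_1, d_2, ...)
    given either event.  On x_0 >= c, dropping d_0 has the same effect in law as
    subtracting c from the whole path ([central_above_drop_first]); that
    operation maps tails to tails and simplices to simplices, so the conditional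
    law is central ([disintegrates_above]), and the other part is central as a
    difference ([disintegrates_sub]).  If P is ergodic, both conditional laws
    are P itself, hence P(x_0 >= c + s) = P(x_0 >= c) P(x_0 >= s)
    ([ergodic_above], [survivalD]).  By monotonicity
    P(x_0 >= c) = exp(- c / lambda) ([survival_exp]), and the formula for
    orthants says that the increments are independent and exponential.

    The law of large numbers follows from a second moment bound
    ([variance_vertex]): the squares of the deviations of x_n / (n+1) from
    lambda are summable along n = k^2 ([vertex_squares_cvg]), and x_n is
    nondecreasing in n, which controls it between two consecutive squares
    ([cvg_interpolate_squares]). *)

(** * Lebesgue measure on tuples *)

Local Notation pushforward_measure :=
  measure_function_pushforward__canonical__measure_function_Measure
  (only parsing).

Lemma measurable_preimageT d d' (T : measurableType d) (T' : measurableType d')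
    (f : T -> T') (B : set T') : measurable_fun [set: T] f -> measurable B ->
  measurable (f @^-1` B).
Proof. by move=> mf mB; rewrite -[X in measurable X]setTI; exact: mf. Qed.

Lemma lebesgue_measure_translation (R : realType) (t : R) (A : set R) :
  measurable A ->
  lebesgue_measure ((fun x => x - t) @^-1` A) = lebesgue_measure A :> \bar R.
Proof.
move=> mA.
pose f := (fun x => x - t) : measurableTypeR R -> measurableTypeR R.
have mf : measurable_fun [set: measurableTypeR R] f by exact: measurable_funB.
rewrite -[LHS]/(pushforward lebesgue_measure f A); apply/esym.
apply: lebesgue_measure_unique mA => //.
move=> _ [[a b] /= ab <-].
rewrite /pushforward (_ : f @^-1` _ = `]a + t, b + t]%classic); last first.
  by apply/seteqP; split => x /=; rewrite !in_itv/= /f ltrBrDr lerBlDr.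
rewrite !lebesgue_measure_itv/= !lte_fin ltrD2r.
by case: ifP => // _; congr (_%:E); rewrite /=; ring.
Qed.

Definition cons_tuple (T : Type) (m : nat) (p : T * m.-tuple T) : m.+1.-tuple T :=
  [tuple of p.1 :: p.2].

Lemma measurable_cons_tuple (R : realType) (m : nat) :
  measurable_fun [set: measurableTypeR R * m.-tuple R] (@cons_tuple R m).
Proof.
exact: (@measurable_cons _ _ _ R fst m snd).
Qed.

(** A measure with a proof of sigma-finiteness, as an element of the
    corresponding structure. *)
Section sigma_finite_of.
Context d (T : measurableType d) (R : realType).
Variables (mu : {measure set T -> \bar R}).

Definition sigma_finite_of & sigma_finite [set: T] mu : set T -> \bar R := mu.
Hypothesis muS : sigma_finite [set: T] mu.

HB.instance Definition _ := Measure.copy (sigma_finite_of muS) mu.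
HB.instance Definition _ :=
  Measure_isSigmaFinite.Build _ _ _ (sigma_finite_of muS) muS.

End sigma_finite_of.

(** The boxes witness that Lebesgue measure on tuples is sigma-finite, and they
    bound the volume of the simplices. *)
Definition box (R : realType) (n : nat) (k : R) : set (n.-tuple R) :=
  [set s | forall i, tnth s i \in `[- k, k]].
Arguments box {R} n k.

Lemma measurable_box (R : realType) (n : nat) (k : R) : measurable (box n k).
Proof.
rewrite (_ : box n k = \bigcap_(i in [set: 'I_n])
    ((fun s : n.-tuple R => tnth s i) @^-1` `[- k, k]%classic)); last first.
  by apply/seteqP; split => s /= sk i => [_|]; apply: sk.
apply: fin_bigcap_measurable => [|i _]; first exact: finite_finset.
by rewrite -[X in measurable X]setTI; exact: measurable_tnth.
Qed.

Lemma cons_tuple_box (R : realType) (n : nat) (k : R) :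
  @cons_tuple R n @^-1` box n.+1 k = `[- k, k]%classic `*` box n k.
Proof.
apply/seteqP; split => -[x s] /= h.
  split; first exact: (h ord0).
  by move=> i; have := h (lift ord0 i); rewrite tnthS.
move=> i; case: (unliftP ord0 i) => [j ->|->]; last exact: h.1.
by rewrite tnthS; exact: h.2.
Qed.

Lemma bigcup_box (R : realType) (n : nat) :
  \bigcup_k box n k%:R = [set: n.-tuple R].
Proof.
rewrite -subTset => s _.
pose M : R := \sum_(i < n) `|tnth s i|.
exists (Num.truncn M).+1 => // i.
rewrite /= in_itv/= -ler_norml.
apply/ltW/(le_lt_trans _ (truncnS_gt M)).
by rewrite /M (bigD1 i)//= lerDl sumr_ge0.
Qed.

(** The iterated product is only a set function by definition; sigma-finiteness
    has to be carried through the induction, because the product with a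
    sigma-finite factor is what makes the next stage a measure. *)
Lemma lebesgue_tuple_measure (R : realType) (n : nat) :
  exists m : {sigma_finite_measure set (n.-tuple R) -> \bar R},
    @lebesgue_tuple R n = m /\ forall k, (m (box n k) < +oo)%E.
Proof.
suff [m [mE mfin]] : exists m : {measure set (n.-tuple R) -> \bar R},
    @lebesgue_tuple R n = m /\ forall k, (m (box n k) < +oo)%E.
  have mS : sigma_finite [set: n.-tuple R] m.
    exists (fun k => box n k%:R); first by rewrite bigcup_box.
    by move=> k; split => //; exact: measurable_box.
  by exists (sigma_finite_of mS).
elim: n => [|n [m [mE mfin]]] /=.
  exists (\d_([tuple] : 0.-tuple R) : probability _ R); split => // k.
  by rewrite /= (le_lt_trans (probability_le1 _ _)) ?ltry//; exact: measurable_box.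
have mS : sigma_finite [set: n.-tuple R] m.
  exists (fun k => box n k%:R); first by rewrite bigcup_box.
  by move=> k; split => //; exact: measurable_box.
pose m' : {sigma_finite_measure set (n.-tuple R) -> \bar R} := sigma_finite_of mS.
pose nu : {measure set (n.+1.-tuple R) -> \bar R} :=
  pushforward_measure
    (@lebesgue_measure R \x m')%E (@measurable_cons_tuple R n).
exists nu; split => [|k]; first by rewrite mE.
rewrite /= /pushforward cons_tuple_box product_measure1E//; last exact: measurable_box.
apply: lte_mul_pinfty => //; last exact: mfin.
rewrite ge0_fin_numE//.
apply: (@le_lt_trans _ _ (lebesgue_measure `[- k, k])) => //.
by rewrite lebesgue_measure_itv/=; case: ifP; rewrite ltry.
Qed.

Definition translate (R : realType) (n : nat) (T : nat -> R) (s : n.-tuple R) :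
  n.-tuple R := [tuple tnth s i - T i | i < n].

Lemma measurable_translate (R : realType) (n : nat) (T : nat -> R) :
  measurable_fun [set: n.-tuple R] (translate T).
Proof.
apply/measurable_fun_tnthP => i.
rewrite (_ : _ \o _ = fun s => tnth s i - T i).
  by apply: measurable_funB => //; exact: measurable_tnth.
by apply/funext => s /=; rewrite tnth_mktuple.
Qed.

Lemma translate_cons (R : realType) (n : nat) (T : nat -> R) (x : R)
    (s : n.-tuple R) :
  translate T (cons_tuple (x, s)) = cons_tuple (x - T 0, translate (T \o S) s).
Proof.
apply: eq_from_tnth => i; rewrite tnth_mktuple.
case: (unliftP ord0 i) => [j ->|-> //].
by rewrite !tnthS tnth_mktuple lift0.
Qed.

(** Induction on the length: Fubini reduces to the invariance of the tail
    factor inside the integral and of the first factor outside. *)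
Lemma lebesgue_tuple_translate (R : realType) (n : nat) (T : nat -> R)
    (A : set (n.-tuple R)) : measurable A ->
  lebesgue_tuple (translate T @^-1` A) = lebesgue_tuple A.
Proof.
elim: n T A => [|n IH] T A mA.
  congr lebesgue_tuple; apply/seteqP.
  by split => s /=; rewrite (tuple0 s) (tuple0 (translate _ _)).
have [m [mE _]] := @lebesgue_tuple_measure R n.
pose B := @cons_tuple R n @^-1` A.
have mB : measurable (B : set (measurableTypeR R * n.-tuple R)%type).
  rewrite -[X in measurable X]setTI.
  exact: (@measurable_cons_tuple R n).
rewrite /= /pushforward -/(@cons_tuple R n) -/B /product_measure1 mE.
pose f := (fun x => x - T 0%N) : measurableTypeR R -> measurableTypeR R.
transitivity (\int[lebesgue_measure]_x ((m \o xsection B) \o f) x)%E.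
  apply: eq_integral => x _ /=.
  rewrite -mE -[RHS](IH (T \o S)); last exact: measurable_xsection.
  congr lebesgue_tuple; apply/seteqP.
  by split => s; rewrite /xsection /B /= !inE /= translate_cons.
have mf : measurable_fun [set: measurableTypeR R] f by exact: measurable_funB.
have h := @ge0_integral_pushforward _ _ _ _ R f mf lebesgue_measure setT (m \o xsection B).
rewrite [LHS](_ : _ =
    (\int[lebesgue_measure]_(x in f @^-1` setT) (m \o xsection B \o f) x)%E); last first.
  by rewrite preimage_setT.
rewrite -h//; last exact: measurable_fun_xsection.
apply: eq_measure_integral => C mC _.
exact: lebesgue_measure_translation.
Qed.

(** * Increments on a simplex *)

(** The 0 in front makes the increment of index 0 the first entry. *)
Definition tuple_increment (R : realType) (n : nat) (s : n.-tuple R) (i : nat) : R :=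
  nth 0 s i - nth 0 (0 :: s) i.

(** A simplex is the set of tuples with nonnegative increments, cut by a bound on
    the last entry (which is 0 by convention for the empty tuple). *)
Lemma simplexE (R : realType) (n : nat) (a : R) :
  simplex n a = [set s | (forall i, (i < n)%N -> 0 <= tuple_increment s i) /\
                          nth 0 (0 :: s) n <= a].
Proof.
apply/seteqP; split => s /=.
  move=> /(pathP 0); rewrite size_rcons size_tuple => h; split.
    move=> i ni; have := h i (leqW ni).
    rewrite -rcons_cons !nth_rcons /= size_tuple ltnS ni (ltnW ni).
    by rewrite subr_ge0.
  have := h n (ltnSn n).
  by rewrite -rcons_cons !nth_rcons/= size_tuple ltnn ltnSn eqxx.
move=> [h1 h2]; apply/(pathP 0) => i; rewrite size_rcons size_tuple ltnS => ni.
rewrite -rcons_cons !nth_rcons/= size_tuple ltnS ni.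
case: ltngtP ni => // [ni _|-> _]; last exact: h2.
by have := h1 _ ni; rewrite subr_ge0.
Qed.

Lemma measurable_nth_tuple (R : realType) (n i : nat) :
  measurable_fun [set: n.-tuple R] (fun s : n.-tuple R => nth 0 s i : R).
Proof.
have [ni|ni] := ltnP i n.
  rewrite (_ : (fun _ => _) = fun s => tnth s (Ordinal ni)).
    exact: measurable_tnth.
  by apply/funext => s; rewrite (tnth_nth 0).
rewrite (_ : (fun _ => _) = cst 0); first exact: measurable_cst.
by apply/funext => s; rewrite nth_default// size_tuple.
Qed.

Lemma measurable_nth_tuple0 (R : realType) (n i : nat) :
  measurable_fun [set: n.-tuple R] (fun s : n.-tuple R => nth 0 (0 :: s) i : R).
Proof.
case: i => [|i]; first exact: measurable_cst.
exact: measurable_nth_tuple.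
Qed.

Lemma measurable_tuple_increment (R : realType) (n i : nat) :
  measurable_fun [set: n.-tuple R] (fun s : n.-tuple R => tuple_increment s i : R).
Proof.
by apply: measurable_funB; [exact: measurable_nth_tuple|exact: measurable_nth_tuple0].
Qed.

Definition increments_ge (R : realType) (n : nat) (t : nat -> R) :
  set (n.-tuple R) := [set s | forall i, (i < n)%N -> t i <= tuple_increment s i].
Arguments increments_ge {R} n t.

Lemma measurable_increments_ge (R : realType) (n : nat) (t : nat -> R) :
  measurable (increments_ge n t).
Proof.
rewrite (_ : increments_ge n t = \bigcap_(i in [set i | (i < n)%N])
  ((fun s : n.-tuple R => tuple_increment s i) @^-1` `[t i, +oo[%classic)); last first.
  by apply/seteqP; split => s /= h i ni; have := h i ni; rewrite /= in_itv/= andbT.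
apply: fin_bigcap_measurable => [|i ni]; first exact: finite_II.
rewrite -[X in measurable X]setTI; apply: measurable_tuple_increment => //.
Qed.

Definition cumul (R : realType) (t : nat -> R) (n : nat) : R := \sum_(j < n) t j.

Lemma nth_translate (R : realType) (n : nat) (T : nat -> R) (s : n.-tuple R) i :
  (i < n)%N -> nth 0 (translate T s) i = nth 0 s i - T i.
Proof.
by move=> ni; rewrite -!(tnth_nth _ _ (Ordinal ni)) tnth_mktuple.
Qed.

(** The translation by (t_0, t_0 + t_1, ...) lowers the increment of index i by
    t_i: this is why the translation vector is [cumul t \o S]. *)
Lemma nth_cons_translate (R : realType) (n : nat) (t : nat -> R)
    (s : n.-tuple R) i : (i <= n)%N ->
  nth 0 (0 :: translate (cumul t \o S) s) i = nth 0 (0 :: s) i - cumul t i.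
Proof.
case: i => [|i] ni /=; first by rewrite /cumul big_ord0 subr0.
exact: (nth_translate (cumul t \o S)).
Qed.

Lemma tuple_increment_translate (R : realType) (n : nat) (t : nat -> R)
    (s : n.-tuple R) i : (i < n)%N ->
  tuple_increment (translate (cumul t \o S) s) i = tuple_increment s i - t i.
Proof.
move=> ni; rewrite /tuple_increment nth_cons_translate ?(ltnW ni)// nth_translate//=.
by rewrite {1}/cumul big_ord_recr /= -/(cumul t i); ring.
Qed.

(** The corner of a simplex cut off by lower bounds on the increments is again a
    simplex, smaller by the sum of the bounds. *)
Lemma simplex_translate (R : realType) (n : nat) (t : nat -> R) (a : R) :
  (forall i, 0 <= t i) ->
  increments_ge n t `&` simplex n a =
  translate (cumul t \o S) @^-1` simplex n (a - cumul t n).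
Proof.
move=> t0; rewrite !simplexE; apply/seteqP; split => s /=.
  move=> [h1 [h2 h3]]; split; last by rewrite nth_cons_translate// lerD2r.
  by move=> i ni; rewrite tuple_increment_translate// subr_ge0; exact: h1.
rewrite nth_cons_translate// lerD2r => -[h1 h2]; split => [i ni|].
  by have := h1 _ ni; rewrite tuple_increment_translate// subr_ge0.
split => // i ni; have := h1 _ ni; rewrite tuple_increment_translate// subr_ge0.
exact: le_trans.
Qed.

Lemma measurable_simplex (R : realType) (n : nat) (a : R) :
  measurable (simplex n a).
Proof.
rewrite simplexE.
rewrite (_ : [set _ | _] = increments_ge n (fun=> 0) `&`
   ((fun s : n.-tuple R => nth 0 (0 :: s) n) @^-1` `]-oo, a]%classic)); last first.
  by apply/seteqP; split => s /=; rewrite in_itv.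
apply: measurableI; first exact: measurable_increments_ge.
by rewrite -[X in measurable X]setTI; exact: measurable_nth_tuple0.
Qed.

Lemma simplex_sub_box (R : realType) (n : nat) (a : R) : simplex n a `<=` box n a.
Proof.
move=> s; rewrite simplexE => -[h1 h2] i.
have mono j k : (j <= k <= n)%N -> nth 0 (0 :: s) j <= nth 0 (0 :: s) k.
  move=> /andP[jk]; rewrite -(subnKC jk); elim: (k - j)%N => [|l IH] kn.
    by rewrite addn0.
  apply: (le_trans (IH _)); first by rewrite (leq_trans _ kn)// leq_add2l.
  rewrite addnS in kn *; have := h1 _ kn; rewrite subr_ge0//.
have i0 : 0 <= tnth s i by rewrite (tnth_nth 0); apply: (mono 0%N i.+1); rewrite ltn_ord.
have ia : tnth s i <= a.
  by rewrite (tnth_nth 0); apply: le_trans h2; apply: (mono i.+1 n); rewrite ltn_ord/=.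
rewrite in_itv/= ia andbT (le_trans _ i0)// oppr_le0.
exact: le_trans ia.
Qed.

Lemma lebesgue_tuple_simplex_fin (R : realType) (n : nat) (a : R) :
  (lebesgue_tuple (simplex n a) < +oo)%E.
Proof.
have [m [-> mfin]] := @lebesgue_tuple_measure R n.
apply: le_lt_trans (mfin a); apply: le_measure; rewrite ?inE.
- exact: measurable_simplex.
- exact: measurable_box.
- exact: simplex_sub_box.
Qed.

Lemma simplex_unif_translate0 (R : realType) (n : nat) (t : nat -> R) (a : R)
    (A : set (n.-tuple R)) : (forall i, 0 <= t i) -> measurable A ->
  simplex_unif n a (translate (cumul t \o S) @^-1` A `&` increments_ge n t) =
  (lebesgue_tuple (A `&` simplex n (a - cumul t n)) /
   lebesgue_tuple (simplex n a))%E.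
Proof.
move=> t0 mA; rewrite /simplex_unif -setIA simplex_translate// -preimage_setI.
rewrite lebesgue_tuple_translate//.
by apply: measurableI => //; exact: measurable_simplex.
Qed.

(** The right-hand side depends on t through its sum only: this is the source of
    the symmetry of central measures. *)
Lemma simplex_unif_increments_ge (R : realType) (n : nat) (t : nat -> R) (a : R) :
  (forall i, 0 <= t i) ->
  simplex_unif n a (increments_ge n t) =
  (lebesgue_tuple (simplex n (a - cumul t n)) / lebesgue_tuple (simplex n a))%E.
Proof.
move=> t0; have := simplex_unif_translate0 a t0 (@measurableT _ (n.-tuple R)).
by rewrite preimage_setT !setTI.
Qed.

(** Conditioned on the corner where the increments are at least t, the uniform
    law on a simplex is the uniform law on the smaller simplex, translated. *)
Lemma simplex_unif_translate (R : realType) (n : nat) (t : nat -> R) (a : R)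
    (A : set (n.-tuple R)) : (forall i, 0 <= t i) -> measurable A ->
  simplex_unif n a (translate (cumul t \o S) @^-1` A `&` increments_ge n t) =
  (simplex_unif n (a - cumul t n) A * simplex_unif n a (increments_ge n t))%E.
Proof.
move=> t0 mA; rewrite simplex_unif_translate0// simplex_unif_increments_ge//.
rewrite /simplex_unif.
have vfin := @lebesgue_tuple_simplex_fin R n (a - cumul t n).
have [m [mE _]] := @lebesgue_tuple_measure R n; rewrite !mE in vfin *.
have mS := @measurable_simplex R n.
have : (m (A `&` simplex n (a - cumul t n)) <= m (simplex n (a - cumul t n)))%E.
  by apply: le_measure; rewrite ?inE//; exact: measurableI.
have := measure_ge0 m (A `&` simplex n (a - cumul t n)).
set x := m (A `&` _); set v' := m (simplex n (a - _)) in vfin *.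
set v := m _; move=> x0 xv'.
have [v'0|v'0] := eqVneq v' 0%E.
  have -> : x = 0%E by apply/le_anti; rewrite x0 -v'0 xv'.
  by rewrite !mul0e.
rewrite -muleA [(v'^-1 * _)%E]muleA.
have v'fin : v' \is a fin_num by rewrite ge0_fin_numE// (le_trans x0).
rewrite (_ : v'^-1 * v' = 1)%E ?mul1e//.
by rewrite muleC divee.
Qed.

Lemma simplex_unif_ge0 (R : realType) (n : nat) (a : R) (A : set (n.-tuple R)) :
  (0 <= simplex_unif n a A)%E.
Proof.
have [m [mE _]] := @lebesgue_tuple_measure R n.
rewrite /simplex_unif mE; by apply: mule_ge0; rewrite ?inve_ge0.
Qed.

(** * The Borel sets of the path space *)

(** The cylinders on the right form a filter base, and the filter they generate
    converges to x coordinatewise, hence in the product topology. *)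
Lemma ptws_nbhs_cylinder (R : realType) (x : {ptws nat -> R})
    (V : set {ptws nat -> R}) : nbhs x V ->
  exists n : nat, [set z : {ptws nat -> R} | forall i, (i < n)%N ->
    `|z i - x i| < n.+1%:R^-1] `<=` V.
Proof.
pose B n := [set z : {ptws nat -> R} | forall i, (i < n)%N ->
  `|z i - x i| < n.+1%:R^-1].
pose F : set_system {ptws nat -> R} := filter_from setT B.
have FF : Filter F.
  apply: filter_from_filter; first by exists 0%N.
  move=> m n _ _; exists (maxn m n) => // z Bz; split=> i ik;
    (apply: (lt_le_trans (Bz i _)); first by rewrite leq_max ik ?orbT);
    by rewrite lef_pV2 ?posrE// ler_nat ltnS leq_max leqnn ?orbT.
suff : F --> x by move=> Fx /Fx [n _ nV]; exists n.
apply/cvg_sup => i A.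
case=> [_ [[C Cop <-] Cxi] CA].
have /nbhs_ballP [e /= e0 eC] : nbhs (x i) C by exact: open_nbhs_nbhs.
(* large enough to constrain coordinate i, to within e *)
pose n := maxn i.+1 (Num.truncn e^-1).
exists n => // z Bz; apply/CA/eC.
rewrite /ball/= distrC; apply: (lt_le_trans (Bz i _)).
  by rewrite /n leq_max ltnSn.
rewrite invf_ple ?posrE// (le_trans (ltW (truncnS_gt _)))// ler_nat ltnS.
by rewrite /n leq_max leqnn orbT.
Qed.

Lemma rat_approx (R : realType) (x e : R) : 0 < e ->
  exists q : rat, `|x - ratr q| < e.
Proof.
move=> e0; have [|q] := @rat_in_itvoo R x (x + e); first by rewrite ltrDl.
rewrite in_itv/= => /andP[xq qe]; exists q.
by rewrite distrC ger0_norm ?subr_ge0 ?(ltW xq)// ltrBlDl.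
Qed.

(** The product topology has a countable base of cylinders with rational centres
    and radii 1 / (2 (n + 1)), so an open set is a countable union of sets measurable
    with respect to the coordinates. *)
Lemma open_in_vertex_algebra (R : realType) (G : set (set (gt_path R)))
    (U : set (gt_path R)) :
  (forall n, measurable_fun [set: g_sigma_algebraType G]
    ((fun x => (set_val (x : gt_path R) : nat -> R) n) : _ -> R)) ->
  open U -> <<s G >> U.
Proof.
move=> mG [V Vop VU].
pose C (p : seq rat * nat) : set (g_sigma_algebraType G) :=
  [set x | forall i, (i < p.2)%N ->
    `|(set_val (x : gt_path R) : nat -> R) i - ratr (nth 0 p.1 i)| <
      (p.2.+1%:R *+ 2)^-1].
have mC p : measurable (C p).
  rewrite (_ : C p = \bigcap_(i in [set i | (i < p.2)%N])
    ((fun x : g_sigma_algebraType G => (set_val (x : gt_path R) : nat -> R) i) @^-1`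
    (ball (ratr (nth 0 p.1 i) : R) ((p.2.+1%:R *+ 2)^-1 : R)))); last first.
    by apply/seteqP; split => x /= h i ip; have := h i ip; rewrite /ball/= distrC.
  apply: fin_bigcap_measurable => [|i ip]; first exact: finite_II.
  rewrite -[X in measurable X]setTI; apply: mG => //.
  exact: measurable_ball.
have -> : U = \bigcup_(p in [set p | C p `<=` U]) C p.
  apply/seteqP; split => [x Ux|x [p /= CU]]; last exact: CU.
  have Vx : nbhs (set_val x : {ptws nat -> R}) V.
    by apply: open_nbhs_nbhs; split => //; rewrite -VU in Ux.
  have [n nV] := ptws_nbhs_cylinder Vx.
  have e0 : 0 < (n.+1%:R *+ 2 : R)^-1 by rewrite invr_gt0 pmulrn_rgt0.
  have /choice [q qP] : forall i, exists q,
      `|(set_val x : nat -> R) i - ratr q| < (n.+1%:R *+ 2)^-1.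
    by move=> i; exact: rat_approx.
  have qn i : (i < n)%N -> nth 0 (mkseq q n) i = q i by move=> ?; rewrite nth_mkseq.
  exists (mkseq q n, n); last by move=> i /= ni; rewrite qn//.
  move=> z /= Cz; rewrite -VU /=; apply: nV => i ni.
  have := Cz i ni; rewrite /= qn// => zq.
  rewrite -(subrKA (ratr (q i))) (le_lt_trans (ler_normD _ _))//.
  have -> : n.+1%:R^-1 = (n.+1%:R *+ 2)^-1 + (n.+1%:R *+ 2)^-1 :> R.
    by rewrite -mulr_natr; field; rewrite nat1r pnatr_eq0.
  by rewrite ltrD// distrC.
rewrite -[<<s G >> _]/(@measurable _ (g_sigma_algebraType G) _) bigcup_mkcond.
apply: countable_bigcupT_measurable => // p.
by case: ifP.
Qed.

(** Measurability into the path space can be checked coordinate by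
    coordinate. *)
Lemma measurable_path (R : realType) d (T : measurableType d)
    (f : T -> path_space R) :
  (forall n, measurable_fun [set: T] (fun w => vertex n (f w))) ->
  measurable_fun [set: T] f.
Proof.
move=> mf; apply: (@measurability _ _ _ (path_space R) _ _ (@open (gt_path R))) => //.
move=> _ [U Uop <-].
pose G : set (set (gt_path R)) :=
  image_set_system [set: T] (f : T -> gt_path R) measurable.
have GG : <<s G >> `<=` G.
  apply: smallest_sub => //; apply: sigma_algebra_image.
  exact: sigma_algebra_measurable.
apply: (GG U); apply: open_in_vertex_algebra Uop => n _ B mB; rewrite setTI.
apply: sub_sigma_algebra; rewrite /G /image_set_system/=.
exact: (mf n).
Qed.

Lemma measurable_tail (R : realType) (n : nat) :
  measurable_fun [set: path_space R] (@tail R n).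
Proof. by apply: measurable_path => k; exact: measurable_vertex. Qed.

Lemma measurable_initial_segment (R : realType) (n : nat) :
  measurable_fun [set: path_space R] (@initial_segment R n).
Proof.
apply/measurable_fun_tnthP => i.
rewrite (_ : _ \o _ = @vertex R i); first exact: measurable_vertex.
by apply/funext => x; rewrite /= tnth_mktuple.
Qed.

Lemma vertex_ge0 (R : realType) (n : nat) (x : path_space R) : 0 <= vertex n x.
Proof. by have [x0 _] := set_valP (x : gt_path R); exact: x0. Qed.

Lemma vertexS (R : realType) (n : nat) (x : path_space R) :
  vertex n x <= vertex n.+1 x.
Proof. by have [_ xS] := set_valP (x : gt_path R); exact: xS. Qed.

Lemma increment_ge0 (R : realType) (n : nat) (x : path_space R) :
  0 <= increment n x.
Proof. by case: n => [|n] /=; rewrite ?subr_ge0 ?vertexS ?vertex_ge0. Qed.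

Lemma vertex_sum (R : realType) (n : nat) (x : path_space R) :
  vertex n x = \sum_(i < n.+1) increment i x.
Proof.
elim: n => [|n IH]; first by rewrite big_ord_recl big_ord0 addr0.
by rewrite big_ord_recr/= -IH; ring.
Qed.

Definition orthant (R : realType) (n : nat) (s : nat -> R) : set (path_space R) :=
  [set x | forall i, (i < n)%N -> s i <= increment i x].

Lemma orthantE (R : realType) (n : nat) (s : nat -> R) :
  orthant n s = \bigcap_(i in [set i | (i < n)%N]) (@increment R i @^-1` `[s i, +oo[).
Proof.
by apply/seteqP; split => x /= h i ni; have := h i ni; rewrite /= in_itv/= andbT.
Qed.

Lemma measurable_orthant (R : realType) (n : nat) (s : nat -> R) :
  measurable (orthant n s).
Proof.
rewrite orthantE; apply: fin_bigcap_measurable => [|i ni]; first exact: finite_II.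
by rewrite -[X in measurable X]setTI; exact: measurable_increment.
Qed.

(** Only nonnegative bounds: the probabilities of these orthants are the ones
    that a central measure determines by a formula. *)
Definition orthants (R : realType) : set (set (path_space R)) :=
  [set A | exists n s, (forall i, 0 <= s i) /\ A = orthant n s].

Lemma orthantsI (R : realType) : setI_closed (@orthants R).
Proof.
move=> _ _ [m [s [s0 ->]]] [n [t [t0 ->]]].
pose r i := Num.max (if (i < m)%N then s i else 0) (if (i < n)%N then t i else 0).
exists (maxn m n), r; split.
  by move=> i; rewrite /r le_max; case: ifP => _; rewrite ?s0 ?lexx.
apply/seteqP; split => x /=.
  move=> [hs ht] i _; rewrite /r ge_max; apply/andP; split;
    by case: ifP => ?; [auto|exact: increment_ge0].
move=> h; split => i ni.
  have /h : (i < maxn m n)%N by rewrite leq_max ni.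
  by rewrite /r ni ge_max => /andP[].
have /h : (i < maxn m n)%N by rewrite leq_max ni orbT.
by rewrite /r ni ge_max => /andP[].
Qed.

Lemma orthants_generate (R : realType) :
  @measurable _ (path_space R) = <<s @orthants R >>.
Proof.
apply/seteqP; split => A.
  apply: smallest_sub; first exact: smallest_sigma_algebra.
  move=> U; apply: open_in_vertex_algebra.
  pose T := g_sigma_algebraType (@orthants R).
  have mi n : measurable_fun [set: T] (fun x : T => increment n (x : path_space R)).
    apply: (measurability _ (RGenCInfty.measurableE R)) => _ [_ [a ->] <-].
    rewrite setTI; apply: sub_sigma_algebra.
    exists n.+1, (fun i => if i == n then Num.max a 0 else 0); split.
      by move=> i; case: ifP => // _; rewrite le_max lexx orbT.
    apply/seteqP; split => x /=; rewrite in_itv/= andbT.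
      by move=> ax i _; case: eqP => [->|_]; rewrite ?ge_max ?ax increment_ge0.
    by move=> /(_ n (ltnSn n)); rewrite eqxx ge_max => /andP[].
  move=> n; rewrite (_ : (fun _ => _) =
      fun x : T => \sum_(i < n.+1) increment i (x : path_space R)).
    by apply: measurable_sum => i; exact: mi.
  by apply/funext => x; rewrite -vertex_sum.
apply: smallest_sub; first exact: sigma_algebra_measurable.
by move=> _ [n [s [_ ->]]]; exact: measurable_orthant.
Qed.

(** The orthants form a pi-system that generates the Borel sets. *)
Lemma path_measure_unique (R : realType)
    (m1 m2 : {measure set (path_space R) -> \bar R}) :
  (m1 setT < +oo)%E ->
  (forall n s, (forall i, 0 <= s i) -> m1 (orthant n s) = m2 (orthant n s)) ->
  forall A, measurable A -> m1 A = m2 A.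
Proof.
move=> m1oo m12 A; apply: (measure_unique (@orthants R) (fun=> setT)) => //.
- exact: orthants_generate.
- exact: orthantsI.
- by move=> _; exists 0%N, (fun=> 0); split => //; apply/seteqP; split.
- exact: bigcup_const.
- by move=> _ [n [s [s0 ->]]]; exact: m12.
Qed.

(** * The symmetry of central measures *)
Lemma path_set_drop_first (R : realType) (x : path_space R) :
  path_set (fun n => vertex n.+1 x - vertex 0 x).
Proof.
have le0 n : vertex 0 x <= vertex n x.
  by elim: n => // n IH; exact: le_trans IH (vertexS n x).
by split=> n; rewrite ?subr_ge0// lerD2r vertexS.
Qed.

Definition drop_first (R : realType) (x : path_space R) : path_space R :=
  SigSub (mem_set (path_set_drop_first x)).

Lemma path_set_lower (R : realType) (c : R) (x : path_space R) :
  path_set (fun n => Num.max (vertex n x - c) 0).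
Proof.
split=> n; first by rewrite le_max lexx orbT.
by rewrite ge_max !le_max lerD2r vertexS lexx orbT.
Qed.

(** The truncation at 0 only serves to make this a path for every x; the map is
    used on paths with x_0 >= c, where it subtracts c. *)
Definition lower (R : realType) (c : R) (x : path_space R) : path_space R :=
  SigSub (mem_set (path_set_lower c x)).

Lemma vertex_drop_first (R : realType) (n : nat) (x : path_space R) :
  vertex n (drop_first x) = vertex n.+1 x - vertex 0 x.
Proof. by []. Qed.

Lemma vertex_lower (R : realType) (c : R) (n : nat) (x : path_space R) :
  vertex n (lower c x) = Num.max (vertex n x - c) 0.
Proof. by []. Qed.

Lemma increment_drop_first (R : realType) (n : nat) (x : path_space R) :
  increment n (drop_first x) = increment n.+1 x.
Proof. by case: n => [//|n] /=; rewrite !vertex_drop_first; ring. Qed.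

Lemma vertex0_le (R : realType) (n : nat) (x : path_space R) :
  vertex 0 x <= vertex n x.
Proof. by elim: n => // n IH; exact: le_trans IH (vertexS n x). Qed.

Lemma vertex_lower_above (R : realType) (c : R) (n : nat) (x : path_space R) :
  c <= vertex 0 x -> vertex n (lower c x) = vertex n x - c.
Proof.
move=> cx; rewrite vertex_lower; apply/max_idPl; rewrite subr_ge0.
exact: le_trans (vertex0_le n x).
Qed.

Lemma increment_lower (R : realType) (c : R) (n : nat) (x : path_space R) :
  c <= vertex 0 x -> increment n (lower c x) =
    increment n x - (if n == 0 then c else 0).
Proof.
by move=> cx; case: n => [|n] /=; rewrite !vertex_lower_above//; ring.
Qed.

Lemma measurable_drop_first (R : realType) :
  measurable_fun [set: path_space R] (@drop_first R).
Proof.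
apply: measurable_path => n; apply: measurable_funB; exact: measurable_vertex.
Qed.

Lemma measurable_lower (R : realType) (c : R) :
  measurable_fun [set: path_space R] (lower c).
Proof.
apply: measurable_path => n; apply: measurable_maxr => //.
by apply: measurable_funB => //; exact: measurable_vertex.
Qed.

Definition above (R : realType) (c : R) : set (path_space R) :=
  [set x | c <= vertex 0 x].

Lemma measurable_above (R : realType) (c : R) : measurable (above c).
Proof.
rewrite (_ : above c = @vertex R 0 @^-1` `[c, +oo[); last first.
  by apply/seteqP; split => x /=; rewrite in_itv/= andbT.
by rewrite -[X in measurable X]setTI; exact: measurable_vertex.
Qed.

Definition head_only (R : realType) (c : R) (i : nat) : R := if i is 0 then c else 0.

Lemma cumul_head_only (R : realType) (c : R) (n : nat) :
  (0 < n)%N -> cumul (head_only c) n = c.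
Proof.
by case: n => // n _; rewrite /cumul big_ord_recl big1 ?addr0.
Qed.

Lemma tuple_increment_initial_segment (R : realType) (n i : nat) (x : path_space R) :
  (i < n)%N -> tuple_increment (initial_segment n x) i = increment i x.
Proof.
move=> ni; rewrite /tuple_increment.
have nthE j (nj : (j < n)%N) : nth 0 (initial_segment n x) j = vertex j x.
  by rewrite -(tnth_nth _ _ (Ordinal nj)) tnth_mktuple.
case: i ni => [|i] ni; first by rewrite nthE// subr0.
by rewrite nthE//= nthE// ltnW.
Qed.

Lemma orthant_initial_segment (R : realType) (n : nat) (s : nat -> R) :
  orthant n s = @initial_segment R n @^-1` increments_ge n s.
Proof.
by apply/seteqP; split => x /= h i ni; have := h i ni;
  rewrite tuple_increment_initial_segment.
Qed.

Lemma above_orthant (R : realType) (c : R) (n : nat) :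
  (0 < n)%N -> above c = orthant n (head_only c).
Proof.
move=> n0; apply/seteqP; split => x /=; last by move=> /(_ 0%N n0).
by move=> cx [|i] _ //=; rewrite (increment_ge0 i.+1).
Qed.

(** Both events have the same conditional probability given the tail, by
    [simplex_unif_increments_ge]. *)
Lemma central_orthant (R : realType) (P : probability (path_space R) R)
    (n : nat) (s : nat -> R) :
  central P -> (forall i, 0 <= s i) -> P (orthant n s) = P (above (cumul s n)).
Proof.
move=> cP s0; case: n => [|n].
  congr (P _); apply/seteqP; split => x // _ /=.
  by rewrite /above /= /cumul big_ord0 vertex_ge0.
rewrite (@above_orthant _ _ n.+1)// !orthant_initial_segment.
have [_ [_ cd]] := cP n.+1 isT.
have h t := cd _ _ (@measurable_increments_ge R n.+1 t) measurableT.
have := h s; have := h (head_only (cumul s n.+1)).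
rewrite !preimage_setT !setIT => -> ->.
apply: eq_integral => x _; rewrite !simplex_unif_increments_ge//.
  by rewrite cumul_head_only.
by case => //=; exact: sumr_ge0.
Qed.

Definition scons (R : realType) (c : R) (s : nat -> R) (i : nat) : R :=
  if i is j.+1 then s j else c.

Lemma cumul_scons (R : realType) (c : R) (s : nat -> R) (n : nat) :
  cumul (scons c s) n.+1 = c + cumul s n.
Proof. by rewrite /cumul big_ord_recl. Qed.

Lemma above_drop_first_orthant (R : realType) (c : R) (n : nat) (s : nat -> R) :
  above c `&` @drop_first R @^-1` orthant n s = orthant n.+1 (scons c s).
Proof.
apply/seteqP; split => x /=.
  by move=> [cx h] [|i] //= ni; have := h _ ni; rewrite increment_drop_first.
move=> h; split; first exact: (h 0%N).
by move=> i ni; rewrite increment_drop_first; exact: (h i.+1).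
Qed.

Lemma above_lower_orthant (R : realType) (c : R) (n : nat) (s : nat -> R) :
  (forall i, 0 <= s i) ->
  above c `&` lower c @^-1` orthant n.+1 s =
  orthant n.+1 (scons (c + s 0%N) (s \o S)).
Proof.
move=> s0; apply/seteqP; split => x /=.
  move=> [cx h] [|i] ni; have := h _ ni; rewrite increment_lower//= ?subr0//.
  by rewrite lerBrDl.
move=> h; have cx : c <= vertex 0 x.
  by apply: le_trans (h 0%N isT); rewrite /= lerDl.
split => // -[|i] ni; rewrite increment_lower//=; have := h _ ni => /=.
  by rewrite lerBrDl.
by rewrite subr0.
Qed.

Section drop_first_laws.
Context (R : realType) (P : probability (path_space R) R).
Hypothesis cP : central P.

(** Orthants of the shortened path are orthants with bound 0 on d_0. *)
Lemma central_drop_first (A : set (path_space R)) : measurable A ->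
  P (@drop_first R @^-1` A) = P A.
Proof.
pose m : {measure set (path_space R) -> \bar R} :=
  pushforward_measure P (@measurable_drop_first R).
apply: (path_measure_unique (m1 := m)) => [|n s s0].
  exact: (le_lt_trans (probability_le1 P measurableT) (ltry _)).
rewrite /= /pushforward.
rewrite (_ : _ @^-1` _ = above 0 `&` @drop_first R @^-1` orthant n s); last first.
  by apply/esym/setIidPr => x _; exact: vertex_ge0.
rewrite above_drop_first_orthant !central_orthant//; last by case.
by rewrite cumul_scons add0r.
Qed.

(** On an orthant with bounds s both sides are P(x_0 >= c + sum s): the bound c
    sits on d_0 alone on the left, and is added to the bound on d_0 on the
    right. *)
Lemma central_above_drop_first (c : R) (A : set (path_space R)) :
  0 <= c -> measurable A ->
  P (above c `&` @drop_first R @^-1` A) = P (above c `&` lower c @^-1` A).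
Proof.
move=> c0.
pose Pc := mrestr P (measurable_above c).
pose m1 : {measure set (path_space R) -> \bar R} :=
  pushforward_measure Pc
    (@measurable_drop_first R).
pose m2 : {measure set (path_space R) -> \bar R} :=
  pushforward_measure Pc
    (@measurable_lower R c).
move=> mA; rewrite ![above c `&` _]setIC; move: A mA.
apply: (path_measure_unique (m1 := m1) (m2 := m2)) => [|n s s0].
  apply: (le_lt_trans (probability_le1 P _) (ltry _)).
  exact: (measurableI _ _ measurableT (measurable_above c)).
rewrite /= /pushforward /Pc /= /mrestr ![_ `&` above c]setIC.
rewrite above_drop_first_orthant central_orthant//; last by case.
rewrite cumul_scons; case: n => [|n].
  rewrite [orthant 0 s](_ : _ = setT); last by apply/seteqP; split.
  by rewrite preimage_setT setIT /cumul big_ord0 addr0.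
rewrite above_lower_orthant// central_orthant; last 2 first.
- exact: cP.
- by case => //=; rewrite addr_ge0.
by rewrite cumul_scons -addrA /cumul big_ord_recl.
Qed.

End drop_first_laws.

(** * Conditioning a central measure on its first coordinate *)
Section finite_of.
Context d (T : measurableType d) (R : realType).
Variables (mu : {measure set T -> \bar R}).

Definition finite_of & fin_num_fun mu : set T -> \bar R := mu.
Hypothesis muF : fin_num_fun mu.

HB.instance Definition _ := Measure.copy (finite_of muF) mu.
HB.instance Definition _ := Measure_isFinite.Build _ _ _ (finite_of muF) muF.

End finite_of.

Lemma finite_measureP d (T : measurableType d) (R : realType)
    (mu : {measure set T -> \bar R}) : (mu [set: T] < +oo)%E ->
  exists m : {finite_measure set T -> \bar R}, (mu : set T -> \bar R) = m.
Proof.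
move=> muT; have muF : fin_num_fun mu.
  move=> A mA; rewrite ge0_fin_numE// (le_lt_trans _ muT)//.
  by apply: le_measure; rewrite ?inE.
by exists (finite_of muF).
Qed.

(** A measure given on sets by a density is integrated with that density: the
    density agrees almost everywhere with the Radon-Nikodym derivative. *)
Lemma integral_density d (T : measurableType d) (R : realType)
    (mu0 nu0 : {measure set T -> \bar R}) (k : T -> \bar R) :
  (mu0 [set: T] < +oo)%E -> (nu0 [set: T] < +oo)%E ->
  measurable_fun [set: T] k -> (forall x, 0 <= k x)%E ->
  (forall B, measurable B -> nu0 B = \int[mu0]_(x in B) k x)%E ->
  forall (h : T -> \bar R) (B : set T),
  measurable_fun [set: T] h -> (forall x, 0 <= h x)%E -> measurable B ->
  (\int[nu0]_(x in B) h x = \int[mu0]_(x in B) (h x * k x))%E.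
Proof.
move=> /finite_measureP[mu ->] /finite_measureP[nu ->].
move=> mk k0 nuE h B mh h0 mB.
have numu : nu `<< mu.
  apply/null_content_dominatesP => A mA muA.
  by rewrite nuE// null_set_integral//; exact: measurable_funTS.
have intk : mu.-integrable [set: T] k.
  apply/integrableP; split => //.
  under eq_integral do rewrite gee0_abs//.
  by rewrite -nuE// -ge0_fin_numE// fin_num_measure.
have intf := Radon_Nikodym_SigmaFinite.f_integrable numu.
have ae : ae_eq mu setT k (Radon_Nikodym_SigmaFinite.f nu mu).
  apply: integral_ae_eq => //; first exact: measurable_int intf.
  by move=> E _ mE; rewrite -Radon_Nikodym_SigmaFinite.f_integral// nuE.
rewrite -(Radon_Nikodym_SigmaFinite.change_of_variables numu)//; last exact: measurable_funTS.
apply: ae_eq_integral => //.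
- apply: emeasurable_funM; apply: measurable_funTS => //.
  exact: measurable_int intf.
- by apply: emeasurable_funM; exact: measurable_funTS.
- apply: filterS ae => x /= kE Bx; congr (_ * _)%E.
  by rewrite -kE.
Qed.

Lemma simplex_neg (R : realType) (n : nat) (a : R) : (0 < n)%N -> a < 0 ->
  simplex n a = set0.
Proof.
move=> n0 a0; rewrite -subset0 => s /simplex_sub_box /(_ (Ordinal n0)).
rewrite in_itv/= => /andP[h1 h2].
have := le_trans h1 h2; lra.
Qed.

Lemma simplex_unif_head_neg (R : realType) (n : nat) (a c : R) : (0 < n)%N ->
  0 <= c -> a < c -> simplex_unif n a (increments_ge n (head_only c)) = 0%E.
Proof.
move=> n0 c0 ac; rewrite simplex_unif_increments_ge; last by case.
rewrite cumul_head_only// simplex_neg ?subr_lt0//.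
have [m [-> _]] := @lebesgue_tuple_measure R n.
by rewrite measure0 mul0e.
Qed.

(** The disintegration property of central measures at level n, for measures of
    any mass: it is linear in the measure, so it passes to differences and
    multiples. *)
Definition disintegrates (R : realType) (n : nat)
    (m : set (path_space R) -> \bar R) : Prop :=
  forall A B, measurable A -> measurable B ->
  (m (@initial_segment R n @^-1` A `&` @tail R n @^-1` B) =
   \int[m]_(w in @tail R n @^-1` B) simplex_unif n (vertex 0 (tail n w)) A)%E.

Lemma initial_segment_lower (R : realType) (n : nat) (c : R) (x : path_space R) :
  (0 < n)%N -> c <= vertex 0 x ->
  initial_segment n (lower c x) =
  translate (cumul (head_only c) \o S) (initial_segment n x).
Proof.
move=> n0 cx; apply: eq_from_tnth => i.
rewrite !tnth_mktuple vertex_lower_above// /= cumul_head_only//.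
Qed.

Lemma tail_lower (R : realType) (n : nat) (c : R) (x : path_space R) :
  tail n (lower c x) = lower c (tail n x).
Proof. by apply: val_inj. Qed.

Section conditioned_above.
Context (R : realType) (P : probability (path_space R) R) (c : R).
Hypotheses (cP : central P) (c0 : 0 <= c).

Definition restrict_above : set (path_space R) -> \bar R :=
  mrestr P (@measurable_above R c).
HB.instance Definition _ := Measure.on restrict_above.

(** Subtracting c commutes with taking tails, and on initial segments it is the
    translation of [simplex_unif_translate].  The factor by which the kernels of
    x_n and x_n - c differ is the conditional probability of x_0 >= c given the
    tail, so it disappears when P is replaced by its restriction. *)
Lemma disintegrates_above (n : nat) : (0 < n)%N ->
  disintegrates n (pushforward restrict_above (lower c)).
Proof.
move=> n0 A B mA mB.
have [_ [mU cd]] := cP n0.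
pose hd : set (n.-tuple R) := increments_ge n (head_only c).
have mhd : measurable hd := @measurable_increments_ge R n _.
have mtr : measurable
    (translate (cumul (head_only c) \o S) @^-1` A : set (n.-tuple R)).
  exact: measurable_preimageT (@measurable_translate R n _) mA.
have mlB : measurable (lower c @^-1` B).
  exact: measurable_preimageT (@measurable_lower R c) mB.
transitivity (P (@initial_segment R n @^-1`
    (translate (cumul (head_only c) \o S) @^-1` A `&` hd)
    `&` @tail R n @^-1` (lower c @^-1` B))).
  rewrite /pushforward /restrict_above /mrestr setIC (@above_orthant _ _ n)//.
  rewrite orthant_initial_segment.
  congr (P _); apply/seteqP; split => x /=.
    move=> [cx [Ax Bx]]; have cx' : above c x.
      by rewrite (above_orthant c n0) orthant_initial_segment.
    by rewrite -initial_segment_lower// -tail_lower.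
  move=> [[Ax cx] Bx]; have cx' : above c x.
    by rewrite (above_orthant c n0) orthant_initial_segment.
  by rewrite initial_segment_lower// tail_lower.
rewrite cd//; last exact: measurableI.
(* h and k are functions of the tail: the kernel of the lowered path, and the
   conditional probability of x_0 >= c *)
pose h (y : path_space R) : \bar R := simplex_unif n (vertex 0 (lower c y)) A.
pose k (y : path_space R) : \bar R := simplex_unif n (vertex 0 y) hd.
transitivity (\int[P]_(x in @tail R n @^-1` (lower c @^-1` B))
    ((h \* k)%E \o tail n) x)%E.
  apply: eq_integral => x _ /=; rewrite simplex_unif_translate//; last by case.
  rewrite cumul_head_only// /h /k -/hd vertex_lower.
  have [cx|cx] := leP c (vertex 0 (tail n x)).
    by rewrite (max_idPl _)// subr_ge0.
  by rewrite (simplex_unif_head_neg n0 c0 cx) !mule0.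
have mh : measurable_fun [set: path_space R] h.
  apply: (measurableT_comp (f := fun y => simplex_unif n (vertex 0 y) A)).
    exact: mU.
  exact: measurable_lower.
have mk : measurable_fun [set: path_space R] k by exact: mU.
have mt := @measurable_tail R n.
pose Pt : {measure set (path_space R) -> \bar R} :=
  pushforward_measure P mt.
pose Pc : {measure set (path_space R) -> \bar R} :=
  pushforward_measure restrict_above mt.
have PtT : (Pt setT < +oo)%E.
  exact: (le_lt_trans (probability_le1 P measurableT) (ltry _)).
have PcT : (Pc setT < +oo)%E.
  apply: (le_lt_trans (probability_le1 P _) (ltry _)).
  exact: (measurableI _ _ measurableT (measurable_above c)).
have k0 y : (0 <= k y)%E by exact: simplex_unif_ge0.
have h0 y : (0 <= h y)%E by exact: simplex_unif_ge0.
have mlow := @measurable_lower R c.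
have PcE D : measurable D -> (Pc D = \int[Pt]_(x in D) k x)%E.
  move=> mD; rewrite ge0_integral_pushforward//; last exact: measurable_funTS.
  rewrite /Pc /= /pushforward /restrict_above /mrestr setIC (@above_orthant _ _ n)//.
  by rewrite orthant_initial_segment cd.
rewrite -[LHS](@ge0_integral_pushforward _ _ _ _ _ _ mt P)//; last 2 first.
- by apply: measurable_funTS; exact: emeasurable_funM.
- by move=> y _; rewrite mule_ge0.
rewrite -(integral_density PtT PcT mk k0 PcE mh h0 mlB).
rewrite ge0_integral_pushforward//; last exact: measurable_funTS.
rewrite ge0_integral_pushforward//.
- rewrite [X in integral _ X _ = _](_ : _ = lower c @^-1` (tail n @^-1` B)).
    by apply: eq_integral => x _; rewrite /h /= tail_lower.
  by apply/seteqP; split => x /=; rewrite tail_lower.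
- exact: measurable_preimageT mt mB.
- apply: measurable_funTS; exact: measurableT_comp (mU _ mA) mt.
- by move=> y _; exact: simplex_unif_ge0.
Qed.

End conditioned_above.

Lemma disintegrates_sub (R : realType) (n : nat)
    (m m1 m2 : {measure set (path_space R) -> \bar R}) :
  (forall A, measurable A ->
    measurable_fun [set: path_space R] (fun y => simplex_unif n (vertex 0 y) A)) ->
  (m1 [set: path_space R] < +oo)%E ->
  (forall A, measurable A -> m A = (m1 A + m2 A)%E) ->
  disintegrates n m -> disintegrates n m1 -> disintegrates n m2.
Proof.
move=> mU m1T mE dm dm1 A B mA mB.
have mt := @measurable_tail R n.
have mB' := measurable_preimageT mt mB.
have mX : measurable (@initial_segment R n @^-1` A `&` tail n @^-1` B).
  apply: measurableI => //.
  exact: measurable_preimageT (@measurable_initial_segment R n) mA.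
have := dm _ _ mA mB.
rewrite (eq_measure_integral (measure_add m1 m2)); last first.
  by move=> D mD _; rewrite mE//; exact/esym/measure_addE.
rewrite ge0_integral_measure_add//; last 2 first.
- by move=> x _; exact: simplex_unif_ge0.
- by apply: measurable_funTS; exact: measurableT_comp (mU _ mA) mt.
rewrite mE// -dm1// ![(m1 _ + _)%E]addeC => /(congr1 (fun z => z - m1
  (@initial_segment R n @^-1` A `&` @tail R n @^-1` B))%E).
have m1X : m1 (@initial_segment R n @^-1` A `&` @tail R n @^-1` B) \is a fin_num.
  rewrite ge0_fin_numE// (le_lt_trans _ m1T)//.
  by apply: le_measure; rewrite ?inE.
by rewrite !addeK.
Qed.

(** Domination by P carries over the almost sure positivity of the
    coordinates. *)
Lemma normalized_central (R : realType) (P : probability (path_space R) R)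
    (m : {measure set (path_space R) -> \bar R}) :
  central P -> (0 < m [set: path_space R])%E ->
  (forall A, measurable A -> (m A <= P A)%E) ->
  (forall n, (0 < n)%N -> disintegrates n m) ->
  exists Q : probability (path_space R) R, central Q /\
    forall A, measurable A -> Q A = (m A * (fine (m setT))^-1%:E)%E.
Proof.
move=> cP m0 mP dm.
have mTP := mP _ measurableT; rewrite probability_setT in mTP.
have mfin : m setT \is a fin_num.
  by rewrite ge0_fin_numE// (le_lt_trans mTP)// ltry.
have r0 : 0 <= (fine (m setT))^-1 by rewrite invr_ge0 fine_ge0.
pose Q : probability (path_space R) R := mnormalize m P.
have QE A : Q A = (m A * (fine (m setT))^-1%:E)%E.
  rewrite -[LHS]/(mnormalize m P A) /mnormalize ifF//.
  apply/negP => /orP[/eqP m0'|/eqP moo].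
    by rewrite m0' ltxx in m0.
  by rewrite moo in mfin.
exists Q; split => // n n0; have [aeP [mU cd]] := cP n n0.
split.
  case: aeP => N [mN N0 sN]; exists N; split => //.
  by rewrite QE (_ : m N = 0) ?mul0e//; apply/le_anti; rewrite measure_ge0 -N0 mP.
split => // A B mA mB; rewrite QE dm//.
pose r := NngNum r0.
rewrite [RHS](eq_measure_integral (mscale r m)); last first.
  by move=> D mD _; apply: (etrans (QE D)); rewrite muleC.
rewrite ge0_integral_mscale// 1?muleC//.
- exact: measurable_preimageT (@measurable_tail R n) mB.
- by apply: measurable_funTS; exact: measurableT_comp (mU _ mA) (@measurable_tail R n).
- by move=> x _; exact: simplex_unif_ge0.
Qed.

(** If 0 < P(x_0 >= c) < 1, then P is the mixture with these weights of two
    central measures, the laws of the path without its first increment given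
    x_0 >= c and given x_0 < c.  Ergodicity forces both to be P.  The degenerate
    weights 0 and 1 are immediate. *)
Lemma ergodic_above (R : realType) (P : probability (path_space R) R) (c : R)
    (A : set (path_space R)) : ergodic P -> 0 <= c -> measurable A ->
  (P (above c `&` lower c @^-1` A) = P (above c) * P A)%E.
Proof.
move=> [cP eP] c0 mA.
have mc := @measurable_above R c.
have mS := measurable_preimageT (@measurable_drop_first R).
(* weight 0 *)
have [p0|p0] := eqVneq (P (above c)) 0%E.
  rewrite p0 mul0e; apply/le_anti; rewrite measure_ge0 andbT -p0.
  apply: le_measure; rewrite ?inE//; apply: measurableI => //.
  exact: measurable_preimageT (@measurable_lower R c) mA.
have sumE D : measurable D ->
    (P D = P (above c `&` @drop_first R @^-1` D) +
           P (~` above c `&` @drop_first R @^-1` D))%E.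
  move=> mD; rewrite -[LHS](central_drop_first cP mD) -measureU.
  - by rewrite -setIUl setUv setTI.
  - by apply: measurableI => //; exact: mS.
  - by apply: measurableI; [exact: measurableC|exact: mS].
  - by rewrite setIACA setICr set0I.
(* weight 1: the event x_0 >= c is almost sure *)
have [q0|q0] := eqVneq (P (~` above c)) 0%E.
  rewrite -central_above_drop_first//.
  have -> : P (above c) = 1%E.
    have := sumE setT measurableT.
    by rewrite probability_setT preimage_setT !setIT q0 adde0.
  rewrite mul1e [RHS]sumE// (_ : P (~` above c `&` _) = 0%E) ?adde0//.
  apply/le_anti; rewrite measure_ge0 andbT -q0.
  apply: le_measure; rewrite ?inE; [|exact: measurableC|exact: subIsetl].
  by apply: measurableI; [exact: measurableC|exact: mS].
pose m1 : {measure set (path_space R) -> \bar R} :=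
  pushforward_measure
    (restrict_above P c) (@measurable_lower R c).
pose m2 : {measure set (path_space R) -> \bar R} :=
  pushforward_measure
    (mrestr P (measurableC mc)) (@measurable_drop_first R).
have m1E D : m1 D = P (above c `&` lower c @^-1` D).
  by rewrite /m1/= /pushforward /restrict_above /mrestr setIC.
have m2E D : m2 D = P (~` above c `&` @drop_first R @^-1` D).
  by rewrite /m2/= /pushforward /mrestr setIC.
have m12 D : measurable D -> (P D = m1 D + m2 D)%E.
  by move=> mD; rewrite m1E m2E -central_above_drop_first// -sumE.
have m1T : m1 setT = P (above c) by rewrite m1E preimage_setT setIT.
have m2T : m2 setT = P (~` above c) by rewrite m2E preimage_setT setIT.
have dm1 n : (0 < n)%N -> disintegrates n m1.
  by move=> n0; exact: (disintegrates_above cP c0 n0).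
have dm2 n : (0 < n)%N -> disintegrates n m2.
  move=> n0; have [_ [mU cd]] := cP n n0.
  apply: (disintegrates_sub (m := P) (m1 := m1)) => //.
  - by rewrite m1T (le_lt_trans (probability_le1 _ _)) ?ltry.
  - exact: dm1.
have [|D mD|P1 [cP1 P1E]] := normalized_central (m := m1) cP _ _ dm1.
- by rewrite m1T lt0e p0 measure_ge0.
- by rewrite m12// leeDl.
have [|D mD|P2 [cP2 P2E]] := normalized_central (m := m2) cP _ _ dm2.
- by rewrite m2T lt0e q0 measure_ge0.
- by rewrite m12// leeDr.
pose t := fine (P (above c)).
have tE : P (above c) = t%:E by rewrite fineK// fin_num_measure.
have t1E : P (~` above c) = (1 - t)%:E by rewrite probability_setC// tE.
have t0 : 0 < t by rewrite -lte_fin -tE lt0e p0 measure_ge0.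
have t1 : 0 < 1 - t by rewrite -lte_fin -t1E lt0e q0 measure_ge0.
have tP1 D : measurable D -> (t%:E * P1 D = m1 D)%E.
  move=> mD; rewrite P1E// m1T tE/= muleCA -EFinM mulfV ?mule1//.
  by rewrite gt_eqF.
have tP2 D : measurable D -> ((1 - t)%:E * P2 D = m2 D)%E.
  move=> mD; rewrite P2E// m2T t1E/= muleCA -EFinM mulfV ?mule1//.
  by rewrite gt_eqF.
have PE : Defs.eq_measure P (fun D => t%:E * P1 D + (1 - t)%:E * P2 D)%E.
  by move=> D mD; rewrite tP1// tP2// m12.
have P12 : Defs.eq_measure P1 P2.
  apply: contrapT => P12; apply: eP; exists P1, P2, t; split => //.
  by rewrite t0 -subr_gt0.
rewrite -m1E -tP1// tE PE// -P12// -ge0_muleDl ?lee_fin ?ltW//.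
by rewrite -EFinD subrKC mul1e.
Qed.

Lemma lower_above (R : realType) (c s : R) : 0 <= s ->
  above c `&` lower c @^-1` above s = above (c + s).
Proof.
move=> s0; apply/seteqP; split => x; rewrite /above/=.
  by move=> [cx]; rewrite vertex_lower_above// lerBrDl.
move=> csx; have cx : c <= vertex 0 x by rewrite (le_trans _ csx)// lerDl.
by split => //; rewrite vertex_lower_above// lerBrDl.
Qed.

(** * The law of the first coordinate *)
Definition survival (R : realType) (P : probability (path_space R) R) (c : R) : R :=
  fine (P (above c)).

Section survival.
Context (R : realType) (P : probability (path_space R) R).
Hypothesis eP : ergodic P.
Lemma survivalE c : P (above c) = (survival P c)%:E.
Proof. by rewrite /survival fineK// fin_num_measure//; exact: measurable_above. Qed.

Lemma survivalD c s : 0 <= c -> 0 <= s ->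
  survival P (c + s) = survival P c * survival P s.
Proof.
move=> c0 s0; apply: EFin_inj; rewrite EFinM -!survivalE -lower_above//.
by rewrite ergodic_above//; exact: measurable_above.
Qed.

Lemma survival_le c s : c <= s -> survival P s <= survival P c.
Proof.
move=> cs; rewrite -lee_fin -!survivalE; apply: le_measure.
- by rewrite inE; exact: measurable_above.
- by rewrite inE; exact: measurable_above.
- by move=> x; exact: le_trans.
Qed.

Lemma survival_le1 c : survival P c <= 1.
Proof. by rewrite -lee_fin -survivalE probability_le1//; exact: measurable_above. Qed.

Lemma survival0 : survival P 0 = 1.
Proof.
apply: EFin_inj; rewrite -survivalE -(probability_setT P); congr (P _).
by apply/seteqP; split => // x _; exact: vertex_ge0.
Qed.

Lemma survivalMn c n : 0 <= c -> survival P (c *+ n) = survival P c ^+ n.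
Proof.
move=> c0; elim: n => [|n IH]; first by rewrite mulr0n survival0 expr0.
by rewrite mulrS exprS survivalD ?IH// mulrn_wge0.
Qed.

End survival.

(** Monotonicity replaces continuity in the Cauchy equation: comparing n c with
    its integer part bounds n |g c - c g 1| by g 1 for every n. *)
Lemma nondecreasing_additive (R : realType) (g : R -> R) :
  (forall x y, 0 <= x -> 0 <= y -> g (x + y) = g x + g y) ->
  (forall x, 0 <= x -> 0 <= g x) ->
  forall c, 0 <= c -> g c = c * g 1.
Proof.
move=> gD g0 c c0.
have g00 : g 0 = 0.
  have := gD 0 0 (lexx _) (lexx _); rewrite addr0 => /eqP.
  by rewrite -subr_eq subrr => /eqP.
have gM x n : 0 <= x -> g (x *+ n) = g x *+ n.
  move=> x0; elim: n => [|n IH]; first by rewrite !mulr0n.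
  by rewrite !mulrS gD ?IH// mulrn_wge0.
have gle x y : 0 <= x -> x <= y -> g x <= g y.
  move=> x0 xy; rewrite -(subrKC x y) gD ?subr_ge0// lerDl.
  by rewrite g0// subr_ge0.
have bound n : `|g c - c * g 1| *+ n <= g 1.
  have nc0 : 0 <= c *+ n by rewrite mulrn_wge0.
  pose k := Num.truncn (c *+ n).
  have kc : k%:R <= c *+ n by rewrite truncn_le.
  have ck : c *+ n <= k.+1%:R by apply/ltW/truncnS_gt.
  have h1 : g 1 *+ k <= g c *+ n by rewrite -!gM//; apply: gle.
  have h2 : g c *+ n <= g 1 *+ k.+1 by rewrite -!gM//; apply: gle.
  have g10 : 0 <= g 1 by exact: g0.
  have h3 : g 1 *+ k <= (c *+ n) * g 1 by rewrite -mulr_natl ler_wpM2r.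
  have h4 : (c *+ n) * g 1 <= g 1 *+ k.+1 by rewrite -(mulr_natl _ k.+1) ler_wpM2r.
  rewrite -normrMn mulrnBl -mulrnAl ler_norml.
  rewrite !mulrS in h2 h4; apply/andP; split; lra.
apply/eqP; rewrite -subr_eq0 -normr_le0 leNgt; apply/negP => d0.
have := bound (Num.truncn (g 1 / `|g c - c * g 1|)).+1.
rewrite leNgt -mulr_natl -ltr_pdivrMr// => /negP; apply.
exact: truncnS_gt.
Qed.

Section survival_exponential.
Context (R : realType) (P : probability (path_space R) R).
Hypothesis eP : ergodic P.
Let cP : central P := eP.1.

(** Otherwise x_0 vanishes almost surely, and by symmetry so does d_1; then
    x_1 = 0 almost surely, which centrality excludes. *)
Lemma survival_gt0_near0 : exists e : R, 0 < e /\ 0 < survival P e.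
Proof.
apply: contrapT => h.
pose e (k : nat) : R := k.+1%:R^-1.
have e0 k : 0 < e k by rewrite invr_gt0.
have null k : P (above (e k)) = 0%E.
  rewrite survivalE; congr EFin; apply/le_anti/andP; split; last first.
    by rewrite fine_ge0.
  by rewrite leNgt; apply/negP => ek; apply: h; exists (e k).
have null1 k : P (orthant 2 (scons 0 (fun=> e k))) = 0%E.
  rewrite central_orthant//; last by case => //= _; exact: ltW.
  by rewrite cumul_scons add0r /cumul big_ord1.
have [[N [mN N0 sN]] _] := cP (ltnSn 0).
have : (P setT <= 0)%E.
  have cover : [set: path_space R] `<=`
      N `|` \bigcup_k (above (e k) `|` orthant 2 (scons 0 (fun=> e k))).
    move=> x _; have [x1|x1] := ltP 0 (vertex 1 x); last first.
      by left; apply: sN => /=; apply/negP; rewrite -leNgt.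
    right; pose d := vertex 1 x / 2.
    have d0 : 0 < d by rewrite divr_gt0.
    exists (Num.truncn d^-1) => //.
    have ed : e (Num.truncn d^-1) <= d.
      by rewrite /e invf_ple ?posrE//; apply/ltW/truncnS_gt.
    have [h0|h0] := leP d (vertex 0 x); [left|right].
      exact: le_trans h0.
    case=> [|[|//]] _ /=; first exact: vertex_ge0.
    by apply: (le_trans ed); move: h0; rewrite /d; lra.
  have nullU : P.-negligible (\bigcup_k (above (e k) `|` orthant 2 (scons 0 (fun=> e k)))).
    apply: negligible_bigcup => k; apply: negligibleU.
      by apply/(negligibleP _ (measurable_above (e k))); exact: null.
    by apply/(negligibleP _ (@measurable_orthant R _ _)); exact: null1.
  have [M [mM M0 UM]] : P.-negligible [set: path_space R].
    apply: (negligibleS cover); apply: negligibleU => //.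
    exact/(negligibleP _ mN).
  by rewrite -M0; apply: le_measure; rewrite ?inE.
by rewrite probability_setT lee_fin ler10.
Qed.

Lemma survival_gt0 c : 0 < survival P c.
Proof.
have [e [e0 Pe]] := survival_gt0_near0.
pose n := (Num.truncn (c / e)).+1.
apply: (@lt_le_trans _ _ (survival P (e *+ n))).
  by rewrite survivalMn// ?ltW// exprn_gt0.
apply: survival_le; rewrite -mulr_natl -ler_pdivrMr//.
exact/ltW/truncnS_gt.
Qed.

(** Otherwise x_0 would exceed every integer almost surely. *)
Lemma survival1_lt1 : survival P 1 < 1.
Proof.
rewrite lt_neqAle survival_le1 andbT; apply/eqP => s1.
have null k : P (~` above (k%:R : R)) = 0%E.
  rewrite probability_setC; last exact: measurable_above.
  by rewrite survivalE -(mulr_natl 1 k) mulr1 survivalMn// s1 expr1n subee.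
have [M [mM M0 UM]] : P.-negligible [set: path_space R].
  apply: (@negligibleS _ _ _ _ (\bigcup_k ~` above (k%:R : R))).
    move=> x _; exists (Num.truncn (vertex 0 x)).+1 => //.
    by apply/negP; rewrite -ltNge; exact: truncnS_gt.
  apply: negligible_bigcup => k.
  by apply/(negligibleP _ (measurableC (measurable_above k%:R))); exact: null.
have : (P setT <= 0)%E by rewrite -M0; apply: le_measure; rewrite ?inE.
by rewrite probability_setT lee_fin ler10.
Qed.

Lemma survival_exp : exists2 lambda : R, 0 < lambda &
  forall c, 0 <= c -> survival P c = expR (- (lambda^-1 * c)).
Proof.
pose g c := - ln (survival P c).
have g1 : 0 < g 1 by rewrite oppr_gt0 ln_lt0// survival_gt0 survival1_lt1.
have gE := @nondecreasing_additive R g _ _.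
exists (g 1)^-1; first by rewrite invr_gt0.
move=> c c0; rewrite invrK mulrC -gE//.
- by rewrite opprK lnK// posrE survival_gt0.
- by move=> x y x0 y0; rewrite /g survivalD// lnM ?posrE ?survival_gt0// opprD.
- by move=> x x0; rewrite oppr_ge0 ln_le0// survival_le1.
Qed.

End survival_exponential.

(** * Independent exponential increments *)
Lemma exponential_prob_ge (R : realType) (r s : R) : 0 < r -> 0 <= s ->
  exponential_prob r `[s, +oo[%classic = (expR (- (r * s)))%:E.
Proof.
move=> r0 s0; rewrite /exponential_prob.
have cE : continuous (fun z : R => expR (- r * z)).
  move=> z; apply: continuous_comp; last exact: continuous_expR.
  by apply: continuousM => //; exact: cst_continuous.
rewrite (@ge0_continuous_FTC2y _ _ (fun x => - (expR (- r * x))) _ 0)//.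
- by rewrite sub0e EFinN oppeK mulNr.
- by move=> x _; apply: exponential_pdf_ge0; exact: ltW.
- apply: (@continuous_subspaceW R^o _ _ [set` `[0, +oo[%R]).
    by move=> x /=; rewrite !in_itv/= !andbT; exact: le_trans.
  exact: within_continuous_exponential_pdf.
- rewrite -oppr0; apply: cvgN.
  rewrite (_ : (fun x => expR (- r * x)) =
               (fun z => expR (- z)) \o (fun z => r * z)); last first.
    by apply: eq_fun => x; rewrite mulNr.
  apply: (@cvg_comp _ _ _ _ _ _ (pinfty_nbhs R)); last exact: cvgr_expR.
  exact: gt0_cvgMry.
- by apply: cvgN; apply/cvg_at_right_filter; exact: cE.
- move=> x; rewrite in_itv/= andbT => sx; apply: derive1_exponential_pdf.
  by rewrite in_itv/= andbT (le_lt_trans s0).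
Qed.

Lemma real_measure_unique (R : realType) (m1 m2 : {measure set R -> \bar R}) :
  (m1 [set: R] < +oo)%E ->
  (forall s : R, m1 `[s, +oo[%classic = m2 `[s, +oo[%classic) ->
  forall A, measurable A -> m1 A = m2 A.
Proof.
move=> m1T m12 A.
apply: (measure_unique (@RGenCInfty.G R) (fun k => `[- k%:R, +oo[%classic)) => //.
- exact: RGenCInfty.measurableE.
- move=> _ _ [x ->] [y ->]; exists (Num.max x y).
  apply/seteqP; split => z /=; rewrite !in_itv/= !andbT ge_max.
    by move=> [-> ->].
  by move=> /andP[].
- by move=> k; exists (- k%:R).
- rewrite -subTset => x _; exists (Num.truncn `|x|).+1 => //=.
  rewrite in_itv/= andbT lerNl (le_trans (ler_norm _))// normrN.
  exact/ltW/truncnS_gt.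
- by move=> _ [x ->].
- move=> k; apply: le_lt_trans m1T.
  by apply: le_measure; rewrite ?inE.
Qed.

Definition increments_in (R : realType) (n : nat) (A : nat -> set R) :
  set (path_space R) := [set x | forall i, (i < n)%N -> A i (increment i x)].

Lemma measurable_increments_in (R : realType) (n : nat) (A : nat -> set R) :
  (forall i, measurable (A i)) -> measurable (increments_in n A).
Proof.
move=> mA; rewrite (_ : increments_in n A =
    \bigcap_(i in [set i | (i < n)%N]) (@increment R i @^-1` A i)).
  apply: fin_bigcap_measurable => [|i ni]; first exact: finite_II.
  exact: measurable_preimageT (@measurable_increment R i) (mA i).
by apply/seteqP; split => x /= h i ni; exact: h.
Qed.

(** From here on the formula for the orthants is all that is used of the
    measure. *)
Section exponential_increments.
Context (R : realType) (P : probability (path_space R) R) (lambda : R).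
Hypothesis lambda0 : 0 < lambda.
Hypothesis orthantP : forall n s, (forall i, 0 <= s i) ->
  P (orthant n s) = (expR (- (lambda^-1 * cumul s n)))%:E.

Let law (i : nat) (B : set R) : R := fine (P (@increment R i @^-1` B)).

Let lawE i B : measurable B -> P (@increment R i @^-1` B) = (law i B)%:E.
Proof.
move=> mB; rewrite fineK// fin_num_measure//.
exact: measurable_preimageT (@measurable_increment R i) mB.
Qed.

Lemma increment_survival (i : nat) (s : R) :
  P (@increment R i @^-1` `[s, +oo[) = (expR (- (lambda^-1 * Num.max s 0)))%:E.
Proof.
pose t j : R := if j == i then Num.max s 0 else 0.
have -> : @increment R i @^-1` `[s, +oo[ = orthant i.+1 t.
  apply/seteqP; split => x /=; rewrite in_itv/= andbT.
    move=> sx j _; rewrite /t; case: eqP => [->|_]; last exact: increment_ge0.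
    by rewrite ge_max sx increment_ge0.
  by move=> /(_ i (ltnSn i)); rewrite /t eqxx ge_max => /andP[].
rewrite orthantP; last first.
  by move=> j; rewrite /t; case: ifP => // _; rewrite le_max lexx orbT.
congr (expR (- (_ * _)))%:E; rewrite /cumul (bigD1 ord_max)//= /t eqxx.
rewrite big1 ?addr0// => j ji; rewrite ifF//.
by apply/negbTE; apply: contra ji => /eqP ji; exact/eqP/val_inj.
Qed.

Lemma increments_in_rays (n : nat) (s : nat -> R) :
  P (increments_in n (fun i => `[s i, +oo[%classic)) =
  (\prod_(i < n) law i `[s i, +oo[%classic)%:E.
Proof.
pose t i := Num.max (s i) 0.
have -> : increments_in n (fun i => `[s i, +oo[%classic) = orthant n t.
  apply/seteqP; split => x /= h i ni; have := h i ni; rewrite /= in_itv/= andbT.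
    by move=> sx; rewrite ge_max sx increment_ge0.
  by rewrite ge_max => /andP[].
rewrite orthantP; last by move=> i; rewrite le_max lexx orbT.
congr EFin; rewrite /cumul mulr_sumr -sumrN expR_sum.
by apply: eq_bigr => i _; rewrite /law increment_survival.
Qed.

(** The rays are replaced by arbitrary Borel sets one coordinate at a time: with
    the other coordinates fixed, both sides are finite measures in the set of
    index k, and they agree on rays by induction. *)
Lemma increments_in_prod (n : nat) (A : nat -> set R) :
  (forall i, measurable (A i)) ->
  P (increments_in n A) = (\prod_(i < n) law i (A i))%:E.
Proof.
move=> mA.
pose B s k i := if (i < k)%N then A i else `[s i, +oo[%classic.
suff H k s : (k <= n)%N ->
    P (increments_in n (B s k)) = (\prod_(i < n) law i (B s k i))%:E.
  have := H n (fun=> 0) (leqnn n); rewrite /B.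
  rewrite (_ : increments_in _ _ = increments_in n A); last first.
    by apply/seteqP; split => x /= h i ni; have := h i ni; rewrite ni.
  by move=> ->; congr EFin; apply: eq_bigr => i _; rewrite ltn_ord.
elim: k s => [|k IH] s kn; first exact: increments_in_rays.
have mB j s' i : measurable (B s' j i) by rewrite /B; case: ifP.
pose upd C i := if i == k then C else B s k i.
have mupd C : measurable C -> forall i, measurable (upd C i).
  by move=> mC i; rewrite /upd; case: ifP.
pose kO := Ordinal kn.
pose Q := \prod_(i < n | i != kO) law i (B s k i).
have Q0 : 0 <= Q by apply: prodr_ge0 => i _; exact: fine_ge0.
have prodE C : \prod_(i < n) law i (upd C i) = Q * law k C.
  rewrite (bigD1 kO)//= /upd eqxx mulrC; congr (_ * _).
  by apply: eq_bigr => i ik; rewrite ifF//; apply/negbTE.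
have updI C : increments_in n (upd C) =
    increments_in n (upd setT) `&` @increment R k @^-1` C.
  apply/seteqP; split => x /=.
    move=> h; split=> [i ni|].
      by have := h i ni; rewrite /upd; case: ifP.
    by have := h k kn; rewrite /upd eqxx.
  by move=> [h hk] i ni; have := h i ni; rewrite /upd; case: eqP => // ->.
have mE := measurable_increments_in n (mupd _ measurableT).
have minc := @measurable_increment R k.
pose m1 : {measure set R -> \bar R} :=
  pushforward_measure (mrestr P mE) minc.
pose m2 : {measure set R -> \bar R} := mscale (NngNum Q0)
  (pushforward_measure P minc).
have m1E C : m1 C = P (increments_in n (upd C)) by rewrite updI setIC.
have m2E C : measurable C -> m2 C = (Q * law k C)%:E.
  by move=> mC; rewrite EFinM -lawE.
have -> : B s k.+1 = upd (A k).
  apply/funext => i; rewrite /B /upd ltnS leq_eqVlt.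
  by case: eqP => [->|].
rewrite prodE -m2E// -m1E; apply: real_measure_unique => // [|t].
  apply: (le_lt_trans (probability_le1 P _) (ltry _)).
  exact: (measurableI _ _ measurableT mE).
rewrite m1E m2E// -prodE.
(* a ray at index k is the induction hypothesis for modified bounds *)
pose s' i := if i == k then t else s i.
have -> : upd `[t, +oo[%classic = B s' k.
  apply/funext => i; rewrite /upd /B /s'.
  by case: eqP => [->|//]; rewrite ltnn.
exact/IH/ltnW.
Qed.

(** A finite family of indices is completed to an initial segment by the trivial
    events. *)
Lemma independent_increments :
  independent_RVs (fun n : nat => @increment R n : {RV P >-> R}).
Proof.
move=> J A mA.
pose A' i := if i \in J then A i else setT.
have mA' i : measurable (A' i) by rewrite /A'; case: ifP => // iJ; exact: mA.
pose n := (\max_(i <- J) i)%N.+1.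
have Jn i : i \in J -> (i < n)%N.
  by move=> iJ; rewrite ltnS (big_rem i)//= leq_maxl.
rewrite (_ : \bigcap_(i in _) _ = increments_in n A'); last first.
  apply/seteqP; split => x /= h i.
    by move=> _; rewrite /A'; case: ifP => // iJ; exact: h.
  by move=> iJ; have := h i (Jn i iJ); rewrite /A' (iJ : i \in J).
rewrite increments_in_prod//.
have -> : (\prod_(i <- J) P (@increment R i @^-1` A i))%E =
    (\prod_(i <- J) (law i (A i))%:E)%E.
  by rewrite big_seq [RHS]big_seq; apply: eq_bigr => i iJ; rewrite lawE//; exact: mA.
rewrite -(big_morph EFin EFinM erefl); congr EFin.
rewrite -(big_mkord xpredT (fun i => law i (A' i))).
rewrite (bigID (fun i => i \in J))/= [X in _ * X]big1 ?mulr1; last first.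
  move=> i iJ; rewrite /A' (negbTE iJ) /law preimage_setT probability_setT//.
rewrite -big_filter; apply: (@etrans _ _ (\prod_(i <- J) law i (A' i))).
  apply: perm_big; apply: uniq_perm => //.
  - by rewrite filter_uniq// iota_uniq.
  - exact: fset_uniq.
  - move=> i; rewrite mem_filter mem_index_iota /=.
    by case: (boolP (i \in J)) => //= /Jn ->.
by rewrite big_seq [RHS]big_seq; apply: eq_bigr => i iJ; rewrite /A' iJ.
Qed.

Lemma increment_law n : Defs.eq_measure
  (distribution P (@increment R n : {RV P >-> R})) (exponential_prob lambda^-1).
Proof.
have r0 : 0 < lambda^-1 by rewrite invr_gt0.
pose ex : {measure set (measurableTypeR R) -> \bar R} :=
  exponential_distribution_exponential_prob__canonical__measure_function_Measure r0.
have mid : measurable_fun [set: measurableTypeR R] (fun x => x : R).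
  by move=> _ B mB; rewrite setTI.
pose m2 : {measure set R -> \bar R} :=
  pushforward_measure ex mid.
move=> B mB; rewrite -[RHS]/(m2 B).
apply: (real_measure_unique (m1 := distribution P (@increment R n : {RV P >-> R}))) => //.
  exact: (le_lt_trans (probability_le1 P measurableT) (ltry _)).
move=> s; rewrite -[LHS]/(P (@increment R n @^-1` `[s, +oo[%classic)) increment_survival.
rewrite -[RHS]/(exponential_prob lambda^-1 `[s, +oo[%classic).
have [s0|s0] := leP 0 s; first by rewrite exponential_prob_ge.
rewrite mulr0 oppr0 expR0; apply/le_anti/andP; split.
  rewrite -[1%:E](_ : exponential_prob lambda^-1 `[0, +oo[%classic = _); last first.
    by rewrite exponential_prob_ge// mulr0 oppr0 expR0.
  apply: (@le_measure _ _ _ ex); rewrite ?inE//.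
  by move=> x /=; rewrite !in_itv/= !andbT; exact/le_trans/ltW.
by rewrite -(integral_exponential_pdf r0); apply: (@le_measure _ _ _ ex); rewrite ?inE.
Qed.

End exponential_increments.

(** * The strong law of large numbers *)
Lemma sqrt_floor (n : nat) : {k : nat | (k ^ 2 <= n < k.+1 ^ 2)%N}.
Proof.
elim: n => [|n [k /andP[kn nk]]]; first by exists 0%N.
have [h|h] := leqP (k.+1 ^ 2) n.+1.
  by exists k.+1; rewrite h (leq_ltn_trans nk)// ltn_sqr.
by exists k; rewrite h (leq_trans kn).
Qed.

Lemma sqrt_floor_cvgny : sval (sqrt_floor n) @[n --> \oo] --> \oo.
Proof.
apply/cvgnyPge => K; near=> n.
have : (K ^ 2 <= n)%N by near: n; exact: nbhs_infty_ge.
case: (sqrt_floor n) => k /= /andP[_ nk] Kn.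
by have := leq_ltn_trans Kn nk; rewrite ltn_sqr ltnS.
Unshelve. all: by end_near. Qed.

Lemma squares_ratio_cvg (R : realType) :
  ((k ^ 2).+1%:R / ((k.+1) ^ 2).+1%:R : R) @[k --> \oo] --> (1 : R).
Proof.
have bnd (k : nat) : 1 - 2 * harmonic k <= ((k ^ 2).+1%:R / ((k.+1) ^ 2).+1%:R : R) <= 1.
  have -> : (k ^ 2).+1%:R = k%:R ^+ 2 + 1 :> R by rewrite -natr1 natrX.
  have -> : (k.+1 ^ 2).+1%:R = (k%:R + 1) ^+ 2 + 1 :> R by rewrite -natr1 natrX -natr1.
  have -> : harmonic k = (k%:R + 1)^-1 :> R by rewrite /harmonic/= -natr1.
  set x : R := k%:R; have x0 : 0 <= x by [].
  have p : 0 < (x + 1) ^+ 2 + 1 by rewrite ltr_wpDl// sqr_ge0.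
  have x1 : 0 < x + 1 by rewrite ltr_wpDl.
  rewrite ler_pdivlMr// ler_pdivrMr// mul1r; apply/andP; split; last by nra.
  set h := (x + 1)^-1; have h0 : 0 < h by rewrite invr_gt0.
  have hE : h * ((x + 1) ^+ 2 + 1) = x + 1 + h by rewrite /h; field; rewrite gt_eqF.
  rewrite mulrBl mul1r -mulrA hE; nra.
apply: (squeeze_cvgr (f := fun k => 1 - 2 * harmonic k) (h := fun=> 1)).
- exact: nearW.
- have : 1 - 2 * harmonic k @[k --> \oo] --> (1 - 2 * 0 : R).
    apply: cvgB; first exact: cvg_cst.
    by apply: cvgM; [exact: cvg_cst|exact: cvg_harmonic].
  by rewrite mulr0 subr0.
- exact: cvg_cst.
Qed.

(** By monotonicity the quotient lies between its values at the two neighbouring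
    squares, up to the factor ((k + 1)^2 + 1) / (k^2 + 1), which tends to 1. *)
Lemma cvg_interpolate_squares (R : realType) (v : nat -> R) (l : R) :
  (forall n, 0 <= v n) -> {homo v : m n / (m <= n)%N >-> m <= n} ->
  (v (k ^ 2)%N / (k ^ 2).+1%:R) @[k --> \oo] --> l ->
  (v n / n.+1%:R) @[n --> \oo] --> l.
Proof.
move=> v0 vmono vl.
pose a k : R := v (k ^ 2)%N / (k ^ 2).+1%:R.
pose r k : R := (k ^ 2).+1%:R / (k.+1 ^ 2).+1%:R.
have r1 : r k @[k --> \oo] --> (1 : R) by exact: squares_ratio_cvg.
have lo : a k * r k @[k --> \oo] --> l.
  by rewrite -[l]mulr1; apply: cvgM.
have hi : a k.+1 * (r k)^-1 @[k --> \oo] --> l.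
  rewrite -[l]mulr1; apply: cvgM; first by rewrite (cvg_shiftS a).
  by rewrite -invr1; apply: cvgV; rewrite ?oner_eq0.
have los := cvg_comp _ _ sqrt_floor_cvgny lo.
have his := cvg_comp _ _ sqrt_floor_cvgny hi.
apply: (squeeze_cvgr _ los his); apply: nearW => n /=.
case: (sqrt_floor n) => k /= /andP[kn nk].
have p m : 0 < m.+1%:R :> R by rewrite ltr0n.
apply/andP; split.
  have -> : a k * r k = v (k ^ 2)%N / (k.+1 ^ 2).+1%:R.
    by rewrite /a /r mulrA mulfVK ?gt_eqF.
  apply: ler_pM => //; first exact: vmono.
  by rewrite lef_pV2 ?posrE// ler_nat ltnS ltnW.
have -> : a k.+1 * (r k)^-1 = v (k.+1 ^ 2)%N / (k ^ 2).+1%:R.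
  by rewrite /a /r invf_div mulrA mulfVK ?gt_eqF.
apply: ler_pM => //; first exact/vmono/ltnW.
by rewrite lef_pV2 ?posrE// ler_nat ltnS.
Qed.

(** The partial sums are bounded by 5 - 4 / (n + 1), a telescoping majorant. *)
Lemma sum_inv_squares_le (R : realType) (n : nat) :
  \sum_(0 <= k < n) ((k ^ 2).+1%:R)^-1 <= 5 :> R.
Proof.
suff : \sum_(0 <= k < n) ((k ^ 2).+1%:R)^-1 <= 5 - 4 / n.+1%:R :> R.
  move=> h; apply: (le_trans h); rewrite lerBlDr lerDl; exact: divr_ge0.
elim: n => [|n IH]; first by rewrite big_geq//; lra.
rewrite big_nat_recr//=; apply: (le_trans (lerD IH (lexx _))).
have -> : (n ^ 2).+1%:R = n%:R ^+ 2 + 1 :> R by rewrite -natr1 natrX.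
rewrite -(natr1 n.+1) -(natr1 n).
set x : R := n%:R; have x0 : 0 <= x by [].
have x1 : 0 < x + 1 by rewrite ltr_wpDl.
have x2 : 0 < x + 1 + 1 by rewrite ltr_wpDl// ltW.
rewrite -subr_ge0.
have -> : 5 - 4 / (x + 1 + 1) - (5 - 4 / (x + 1) + (x ^+ 2 + 1)^-1) =
    (3 * x ^+ 2 - 3 * x + 2) / ((x + 1) * (x + 1 + 1) * (x ^+ 2 + 1)).
  field; rewrite !gt_eqF// ?ltr_wpDl// ?sqr_ge0//.
apply: divr_ge0; first by nra.
by rewrite !mulr_ge0 ?ltW// ltr_wpDl// sqr_ge0.
Qed.

Lemma independent_pair d (T : measurableType d) (R : realType)
    (P : probability T R) (I : choiceType) (X : I -> {RV P >-> R}) (i j : I)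
    (A B : set R) : independent_RVs X -> i != j -> measurable A -> measurable B ->
  P (X i @^-1` A `&` X j @^-1` B) = (P (X i @^-1` A) * P (X j @^-1` B))%E.
Proof.
move=> iX ij mA mB.
have := iX [fset i; j]%fset (fun k => if k == i then A else B).
rewrite big_fsetU1 ?inE//= big_seq_fset1 eqxx eq_sym (negbTE ij) => <-.
  congr (P _); apply/seteqP; split => x /=.
    by move=> [Ax Bx] k /=; rewrite !inE => /orP[] /eqP ->; rewrite ?eqxx// eq_sym (negbTE ij).
  move=> h; split.
    by have := h i; rewrite /= !inE eqxx => /(_ isT).
  by have := h j; rewrite /= !inE eqxx orbT eq_sym (negbTE ij) => /(_ isT).
by move=> k _; case: ifP.
Qed.

(** The joint law is the product of the marginal laws, so Tonelli applies. *)
Lemma integral_mul_independent d (T : measurableType d) (R : realType)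
    (P : probability T R) (X Y : {RV P >-> R}) :
  (forall w, 0 <= X w) -> (forall w, 0 <= Y w) ->
  (forall A B, measurable A -> measurable B ->
    P (X @^-1` A `&` Y @^-1` B) = (P (X @^-1` A) * P (Y @^-1` B))%E) ->
  (\int[P]_w (X w * Y w)%:E = \int[P]_w (X w)%:E * \int[P]_w (Y w)%:E)%E.
Proof.
move=> X0 Y0 XY.
have mXY : measurable_fun [set: T] (fun w => (X w, Y w)) by exact: measurable_fun_pair.
pose m : {measure set (R * R)%type -> \bar R} :=
  pushforward_measure P mXY.
pose f (z : R * R) : \bar R := (`|z.1|%:E * `|z.2|%:E)%E.
have mn : measurable_fun [set: R] (fun x : R => `|x|%:E).
  by apply/measurable_EFinP; exact: normr_measurable.
have mf : measurable_fun [set: R * R] f.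
  apply: emeasurable_funM.
    exact: (measurableT_comp mn measurable_fst).
  exact: (measurableT_comp mn measurable_snd).
have f0 z : (0 <= f z)%E by rewrite /f -EFinM lee_fin mulr_ge0.
transitivity (\int[m]_z f z)%E.
  rewrite ge0_integral_pushforward//.
  rewrite preimage_setT; apply: eq_integral => w _.
  by rewrite /f /= !ger0_norm.
have mE D : measurable D -> (distribution P X \x distribution P Y)%E D = m D.
  by move=> mD; apply: product_measure_unique => //= A B mA mB; exact: XY.
rewrite (eq_measure_integral (distribution P X \x distribution P Y)%E); last first.
  by move=> D mD _; exact/esym/mE.
rewrite fubini_tonelli1// /fubini_F /f /=.
under eq_integral => x _ do rewrite ge0_integralZl//.
rewrite ge0_integralZr//; last exact: integral_ge0.
rewrite !ge0_integral_distribution//.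
by congr (_ * _)%E; apply: eq_integral => w _; rewrite /= ger0_norm.
Qed.

Section moments.
Context (R : realType) (P : probability (path_space R) R) (lambda : R).
Hypothesis lambda0 : 0 < lambda.
Hypothesis orthantP : forall n s, (forall i, 0 <= s i) ->
  P (orthant n s) = (expR (- (lambda^-1 * cumul s n)))%:E.

Let r0 : 0 < lambda^-1. Proof. by rewrite invr_gt0. Qed.

Let D (i : nat) : {RV P >-> R} := @increment R i.

Let iD : independent_RVs D := independent_increments orthantP.

Lemma expectation_increment i : (\int[P]_x (increment i x)%:E = lambda%:E)%E.
Proof.
have := @ge0_expectation_ccdf _ _ _ P (D i) (increment_ge0 i).
rewrite expectation_def => ->.
have ccdfE s : 0 <= s -> ccdf (D i) s = (expR (- (lambda^-1 * s)))%:E.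
  move=> s0; rewrite /ccdf (increment_law lambda0 orthantP)//.
  rewrite /exponential_prob integral_itv_obnd_cbnd.
    exact: exponential_prob_ge.
  apply: measurable_funTS; apply/measurable_EFinP.
  exact: measurable_exponential_pdf.
transitivity (\int[lebesgue_measure]_(s in `[0%R, +oo[)
    (lambda%:E * (exponential_pdf lambda^-1 s)%:E))%E.
  apply: eq_integral => s; rewrite inE/= in_itv/= andbT => s0.
  rewrite ccdfE// exponential_pdfE// -EFinM mulrA mulfV ?mul1r ?gt_eqF//.
  by rewrite mulNr.
rewrite ge0_integralZl//.
- have := exponential_prob_ge r0 (lexx 0); rewrite /exponential_prob => ->.
  by rewrite mulr0 oppr0 expR0 mule1.
- apply: measurable_funTS; apply/measurable_EFinP.
  exact: measurable_exponential_pdf.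
- by move=> s _; rewrite lee_fin exponential_pdf_ge0// ltW.
- by rewrite lee_fin ltW.
Qed.

Lemma expectation_increment_mul i j : i != j ->
  (\int[P]_x (increment i x * increment j x)%:E = (lambda ^+ 2)%:E)%E.
Proof.
move=> ij.
have := @integral_mul_independent _ _ R P (D i) (D j) (increment_ge0 i) (increment_ge0 j).
move=> /(_ (fun A B => independent_pair iD ij)) ->.
by rewrite !expectation_increment -EFinM expr2.
Qed.

(** Twice the minimum of two independent exponential variables has the same
    exponential law. *)
Lemma min_increment_law (i : nat) (s : R) :
  P [set x | s <= 2 * Num.min (increment i x) (increment i.+1 x)] =
  P (@increment R i @^-1` `[s, +oo[).
Proof.
rewrite (increment_survival orthantP).
have -> : [set x | s <= 2 * Num.min (increment i x) (increment i.+1 x)] =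
    D i @^-1` `[s / 2, +oo[ `&` D i.+1 @^-1` `[s / 2, +oo[.
  apply/seteqP; split => x /=; rewrite !in_itv/= !andbT.
    by rewrite mulrC -ler_pdivrMr// le_min => /andP[].
  by move=> [h1 h2]; rewrite mulrC -ler_pdivrMr// le_min h1.
rewrite (independent_pair iD)//; last by rewrite neq_ltn ltnSn.
rewrite !(increment_survival orthantP) -EFinM -expRD; congr (expR _)%:E.
rewrite -opprD -mulrDr; congr (- (_ * _)).
by rewrite /Num.max; case: ifPn; case: ifPn; rewrite -?leNgt; lra.
Qed.

(** By [min_increment_law] the second moment is the mean of 4 min(d_i, d_(i+1))^2,
    which is at most 4 d_i d_(i+1). *)
Lemma second_moment_increment i :
  (\int[P]_x (increment i x ^+ 2)%:E <= (4 * lambda ^+ 2)%:E)%E.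
Proof.
pose M (x : path_space R) : R := 2 * Num.min (increment i x) (increment i.+1 x).
have mM : measurable_fun [set: path_space R] M.
  apply: measurable_funM => //; apply: measurable_minr; exact: measurable_increment.
pose m1 : {measure set R -> \bar R} :=
  pushforward_measure P
    (@measurable_increment R i).
pose m2 : {measure set R -> \bar R} :=
  pushforward_measure P mM.
have m12 A : measurable A -> m1 A = m2 A.
  apply: real_measure_unique => [|s].
    exact: (le_lt_trans (probability_le1 P measurableT) (ltry _)).
  rewrite -[LHS]/(P (@increment R i @^-1` `[s, +oo[%classic)) -min_increment_law.
  by congr (P _); apply/seteqP; split => x; rewrite /M /= in_itv/= andbT.
have msq : measurable_fun [set: R] (fun x : R => (x ^+ 2)%:E).
  by apply/measurable_EFinP; exact: exprn_measurable.
have -> : (\int[P]_x (increment i x ^+ 2)%:E = \int[P]_x (M x ^+ 2)%:E)%E.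
  transitivity (\int[m1]_y (y ^+ 2)%:E)%E.
    by rewrite ge0_integral_pushforward// => y _; rewrite lee_fin sqr_ge0.
  rewrite (eq_measure_integral m2); last by move=> A mA _; exact: m12.
  by rewrite ge0_integral_pushforward// => y _; rewrite lee_fin sqr_ge0.
have -> : (4 * lambda ^+ 2)%:E =
    (\int[P]_x (4%:E * (increment i x * increment i.+1 x)%:E))%E.
  rewrite ge0_integralZl//.
  - by rewrite expectation_increment_mul// neq_ltn ltnSn.
  - by apply/measurable_EFinP; apply: measurable_funM; exact: measurable_increment.
  - by move=> x _; rewrite lee_fin mulr_ge0// increment_ge0.
apply: ge0_le_integral => //.
- by move=> x _; rewrite lee_fin sqr_ge0.
- exact: measurableT_comp msq mM.
- apply: measurable_funeM; apply/measurable_EFinP.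
  by apply: measurable_funM; exact: measurable_increment.
- move=> x _; rewrite -EFinM lee_fin /M exprMn -natrX ler_pM2l//.
  rewrite expr2; have := increment_ge0 i x; have := increment_ge0 i.+1 x.
  by move=> a b; apply: ler_pM; rewrite ?le_min ?a ?b// ge_min lexx ?orbT.
Qed.

Lemma expectation_vertex n :
  (\int[P]_x (vertex n x)%:E = (n.+1%:R * lambda)%:E)%E.
Proof.
under eq_integral do rewrite vertex_sum -sumEFin.
rewrite ge0_integral_sum//; last 2 first.
- by move=> i; apply/measurable_EFinP; exact: measurable_increment.
- by move=> i x _; rewrite lee_fin increment_ge0.
under eq_bigr do rewrite expectation_increment.
by rewrite sumEFin sumr_const card_ord mulr_natl.
Qed.

Lemma second_moment_vertex n :
  (\int[P]_x (vertex n x ^+ 2)%:E <=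
   (n.+1%:R * (4 * lambda ^+ 2) + (n.+1%:R * lambda) ^+ 2)%:E)%E.
Proof.
have mI (i j : nat) : measurable_fun [set: path_space R]
    (fun x => (increment i x * increment j x)%:E).
  apply/measurable_EFinP; apply: measurable_funM; exact: measurable_increment.
have I0 (i j : nat) x : (0 <= (increment i x * increment j x)%:E)%E.
  by rewrite lee_fin mulr_ge0// increment_ge0.
have -> : (\int[P]_x (vertex n x ^+ 2)%:E =
    \sum_(i < n.+1) \sum_(j < n.+1) \int[P]_x (increment i x * increment j x)%:E)%E.
  transitivity (\int[P]_x (\sum_(i < n.+1) \sum_(j < n.+1)
      (increment i x * increment j x)%:E))%E.
    apply: eq_integral => x _.
    rewrite expr2 vertex_sum mulr_suml -sumEFin; apply: eq_bigr => i _.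
    by rewrite mulr_sumr -sumEFin.
  rewrite ge0_integral_sum//; last 2 first.
  - by move=> i; apply: emeasurable_sum.
  - by move=> i x _; apply: sume_ge0 => j _.
  by apply: eq_bigr => i _; rewrite ge0_integral_sum.
apply: (@le_trans _ _ (\sum_(i < n.+1) (4 * lambda ^+ 2 + n.+1%:R * lambda ^+ 2)%:E)%E).
  apply: lee_sum => i _; rewrite (bigD1 i)//= EFinD; apply: leeD.
    by under eq_integral do rewrite -expr2; exact: second_moment_increment.
  apply: (@le_trans _ _ (\sum_(j < n.+1) (lambda ^+ 2)%:E)%E); last first.
    by rewrite sumEFin sumr_const card_ord mulr_natl.
  rewrite [leRHS](bigD1 i)//=; rewrite -[leLHS]add0e; apply: leeD.
    by rewrite lee_fin sqr_ge0.
  apply: lee_sum => j ji; rewrite expectation_increment_mul//.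
  by apply: contra ji => /eqP ij; exact/eqP/val_inj.
by rewrite sumEFin sumr_const card_ord lee_fin -mulr_natl; lra.
Qed.

(** With a the mean of x_n, integrate (x_n - a)^2 + 2 a x_n = x_n^2 + a^2: all
    four terms are nonnegative. *)
Lemma variance_vertex n :
  (\int[P]_x ((vertex n x - n.+1%:R * lambda) ^+ 2)%:E <=
   (n.+1%:R * (4 * lambda ^+ 2))%:E)%E.
Proof.
set a := n.+1%:R * lambda.
have a0 : 0 <= a by rewrite mulr_ge0// ltW.
have mv := @measurable_vertex R n.
have msq : measurable_fun [set: path_space R] (fun x => (vertex n x ^+ 2)%:E).
  by apply/measurable_EFinP; exact: measurable_funX.
have mdev : measurable_fun [set: path_space R] (fun x => ((vertex n x - a) ^+ 2)%:E).
  by apply/measurable_EFinP; apply: measurable_funX; exact: measurable_funB.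
have mlin : measurable_fun [set: path_space R] (fun x => (2 * a * vertex n x)%:E).
  by apply/measurable_EFinP; exact: measurable_funM.
have v0 x := @vertex_ge0 R n x.
have : (\int[P]_x (((vertex n x - a) ^+ 2)%:E + (2 * a * vertex n x)%:E) =
    \int[P]_x ((vertex n x ^+ 2)%:E + (a ^+ 2)%:E))%E.
  by apply: eq_integral => x _; rewrite -!EFinD; congr EFin; ring.
rewrite ge0_integralD//; last 2 first.
- by move=> x _; rewrite lee_fin sqr_ge0.
- by move=> x _; rewrite lee_fin mulr_ge0// mulr_ge0.
rewrite ge0_integralD//; last 2 first.
- by move=> x _; rewrite lee_fin sqr_ge0.
- by move=> x _; rewrite lee_fin sqr_ge0.
rewrite integral_cst//= probability_setT mule1.
have -> : (\int[P]_x (2 * a * vertex n x)%:E = (2 * a * a)%:E)%E.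
  under eq_integral do rewrite EFinM.
  rewrite ge0_integralZl//; last 3 first.
  - exact/measurable_EFinP.
  - by move=> x _; rewrite lee_fin.
  - by rewrite lee_fin mulr_ge0.
  by rewrite expectation_vertex -EFinM.
move=> E; have h := leeD2r (a ^+ 2)%:E (second_moment_vertex n).
rewrite -E -/a in h.
rewrite -(@leeD2rE _ (2 * a * a)%:E)//; apply: (le_trans h).
by rewrite -!EFinD lee_fin; lra.
Qed.

(** The mean of the k-th squared deviation is at most 4 lambda^2 / (k^2 + 1), so
    the series of the squared deviations has finite mean and converges almost
    surely. *)
Lemma vertex_squares_cvg :
  {ae P, forall x, (vertex (k ^ 2)%N x / (k ^ 2).+1%:R) @[k --> \oo] --> lambda}.
Proof.
pose f k (x : path_space R) : R := (vertex (k ^ 2)%N x / (k ^ 2).+1%:R - lambda) ^+ 2.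
have f0 k x : 0 <= f k x by exact: sqr_ge0.
have mf k : measurable_fun [set: path_space R] (fun x => (f k x)%:E).
  apply/measurable_EFinP; apply: measurable_funX; apply: measurable_funB => //.
  by apply: measurable_funM => //; exact: measurable_vertex.
have intf k : (\int[P]_x (f k x)%:E <= (4 * lambda ^+ 2 * (k ^ 2).+1%:R^-1)%:E)%E.
  set N : R := (k ^ 2).+1%:R; have N0 : 0 < N by rewrite ltr0n.
  have -> : (\int[P]_x (f k x)%:E = (N ^- 2)%:E *
      \int[P]_x ((vertex (k ^ 2)%N x - N * lambda) ^+ 2)%:E)%E.
    rewrite -ge0_integralZl//.
    - apply: eq_integral => x _; rewrite -EFinM; congr EFin; rewrite /f -/N.
      by field; rewrite gt_eqF.
    - apply/measurable_EFinP; apply: measurable_funX; apply: measurable_funB => //.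
      exact: measurable_vertex.
    - by move=> x _; rewrite lee_fin sqr_ge0.
    - by rewrite lee_fin invr_ge0 sqr_ge0.
  apply: (@le_trans _ _ ((N ^- 2)%:E * (N * (4 * lambda ^+ 2))%:E)%E).
    apply: lee_wpmul2l; first by rewrite lee_fin invr_ge0 sqr_ge0.
    exact: variance_vertex.
  rewrite -EFinM lee_fin le_eqVlt; apply/orP; left; apply/eqP.
  by field; rewrite gt_eqF.
pose F x := (\sum_(0 <= k <oo) (f k x)%:E)%E.
have F0 x : (0 <= F x)%E by apply: nneseries_ge0 => k _ _; rewrite lee_fin.
have mF : measurable_fun [set: path_space R] F.
  by apply: ge0_emeasurable_sum => // k x _ _; rewrite lee_fin.
have intF : (\int[P]_x F x <= (4 * lambda ^+ 2 * 5)%:E)%E.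
  rewrite integral_nneseries//; last by move=> k x _; rewrite lee_fin.
  apply: lime_le.
    by apply: is_cvg_nneseries => k _ _; apply: integral_ge0 => x _; rewrite lee_fin.
  apply: nearW => n.
  apply: (@le_trans _ _ (\sum_(0 <= k < n) (4 * lambda ^+ 2 * (k ^ 2).+1%:R^-1)%:E)%E).
    by apply: lee_sum => k _; exact: intf.
  rewrite sumEFin lee_fin -mulr_sumr ler_wpM2l ?sum_inv_squares_le//.
  by rewrite mulr_ge0// sqr_ge0.
have iF : P.-integrable [set: path_space R] F.
  apply/integrableP; split => //.
  under eq_integral do rewrite gee0_abs//.
  exact: (le_lt_trans intF (ltry _)).
apply: filterS (integrable_ae measurableT iF) => x /(_ I) Ffin.
have fcvg : f ^~ x @ \oo --> 0.
  apply: cvg_series_cvg_0; apply: nondecreasing_is_cvgn.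
    by apply/nondecreasing_series => // k _ _.
  exists (fine (F x)) => _ [n _ <-].
  rewrite -lee_fin fineK// /series/= -sumEFin.
  by apply: nneseries_lim_ge => k _ _; rewrite lee_fin.
apply/cvgrPdist_lt => e e0.
have e20 : 0 < e ^+ 2 by rewrite exprn_gt0.
have /cvgrPdist_lt/(_ _ e20) := fcvg; apply: filterS => k.
rewrite sub0r normrN ger0_norm// /f -real_normK ?num_real//.
by rewrite ltr_pXn2r// ?nnegrE// ?ltW// distrC.
Qed.

Lemma vertex_cvg : {ae P, forall x : path_space R,
  (arithmetic_mean (fun n => increment n x) @ \oo --> lambda) /\
  ((fun n => vertex n x / n%:R) @ \oo --> lambda)}.
Proof.
apply: filterS vertex_squares_cvg => x sq.
have vS : (vertex n x / n.+1%:R) @[n --> \oo] --> lambda.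
  apply: cvg_interpolate_squares => //; first by move=> n; exact: vertex_ge0.
  by apply: homo_leq => [//|? ? ?|n]; [exact: le_trans|exact: vertexS].
split.
  rewrite (_ : arithmetic_mean _ = fun n => vertex n x / n.+1%:R)//.
  by apply/funext => n; rewrite /arithmetic_mean/= /series/= big_mkord -vertex_sum mulrC.
rewrite -cvg_shiftS/=.
have -> : (fun n => vertex n.+1 x / n.+1%:R) =
    (fun n => (vertex n.+1 x / n.+2%:R) * (n.+2%:R / n.+1%:R)).
  by apply/funext => n; rewrite mulrA mulfVK.
rewrite -[lambda]mulr1; apply: cvgM.
  by rewrite (cvg_shiftS (fun n => vertex n x / n.+1%:R)).
have -> : (fun n => n.+2%:R / n.+1%:R : R) = (fun n => 1 + harmonic n).
  by apply/funext => n; rewrite /harmonic/= -(natr1 n.+1) mulrDl mulfV// mul1r.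
rewrite -[X in _ --> X]addr0; apply: cvgD; first exact: cvg_cst.
exact: cvg_harmonic.
Qed.

End moments.

Theorem mainTheorem3 (R : realType) (P : probability (path_space R) R) :
  ergodic P ->
  exists lambda : R,
    [/\ 0 < lambda,
        exponential_walk lambda P
      & {ae P, forall x : path_space R,
          (arithmetic_mean (fun n => increment n x) @ \oo --> lambda) /\
          ((fun n => vertex n x / n%:R) @ \oo --> lambda)}].
Proof.
move=> eP; have [lambda lambda0 survP] := survival_exp eP.
have orthantP n s : (forall i, 0 <= s i) ->
    P (orthant n s) = (expR (- (lambda^-1 * cumul s n)))%:E.
  move=> s0; rewrite (central_orthant _ eP.1)// survivalE survP//.
  exact: sumr_ge0.
exists lambda; split => //; last exact: vertex_cvg lambda0 orthantP.
split; first exact: independent_increments orthantP.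
exact: increment_law lambda0 orthantP.
Qed.
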